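(* Let $n\ge 1$ and let $S$ be a projective transformation of the sphere $S^n$, induced by $A\in GL_+(n+1)$, i.e. $S(p)=Ap/\|Ap\|$. Let $A=PO$ be the algebraic polar factorization, with $P$ positive definite self adjoint and $O$ orthogonal. Then the Brenier-McCann polar factorization of $S$ coincides with the algebraic polar factorization $PO$ of $S$ if and only if $P$ has at most two distinct eigenvalues. Here coincidence of the factorizations means: if $S=T\circ U$ is the (a.e. unique) factorization with $U:S^n\to S^n$ volume preserving and $T:S^n\to S^n$ the optimal transportation map between $\mathrm{vol}_{S^n}$ and $S_{\#}(\mathrm{vol}_{S^n})$, then $T(p)=Pp/\|Pp\|$ and $U(p)=Op$ for a.e. $p\in S^n$.
   Context: $S^n$ is the unit sphere centered at the origin of $\mathbb{R}^{n+1}$ with its round metric, Riemannian measure $\mathrm{vol}_{S^n}$ and geodesic distance $d$. $GL_+(n+1)$ is the group of linear automorphisms of $\mathbb{R}^{n+1}$ with positive determinant. Optimal maps: consider the cost $c(p,q)=\frac12 d(p,q)^2$. For a Borel map $F$ and a finite Borel measure $\mu$, $F_{\#}\mu$ is the push-forward, $(F_{\#}\mu)(B)=\mu(F^{-1}(B))$. A (Borel) map $T:S^n\to S^n$ is an optimal transportation map between $\mu$ and $\nu$ if $T_{\#}\mu=\nu$ and $T$ minimizes $\int_{S^n} c(x,T'(x))\,d\mu(x)$ among all maps $T'$ with $T'_{\#}\mu=\nu$. By McCann's theorem, with $\mu=\mathrm{vol}_{S^n}$, a map $S$ of $S^n$ pushing forward $\mu$ to $\nu$ factors uniquely a.e.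 as $S=T\circ U$ with $U$ volume preserving ($U_{\#}\mu=\mu$) and $T$ the optimal transportation map between $\mu$ and $\nu$; this is the Brenier-McCann polar factorization of $S$. Projective transformations: for $n\ge 2$, a projective transformation of $S^n$ is an orientation preserving diffeomorphism $F$ of $S^n$ such that for any geodesic $\gamma$, $F\circ\gamma$ is a reparametrization (not necessarily of constant speed) of a geodesic. For $n\ge2$ these are exactly the maps $p\mapsto Ap/\|Ap\|$ with $A\in GL_+(n+1)$; for $n=1$ the projective transformations of $S^1$ are by definition the maps of this form with $A\in GL_+(2)$. ($A$ is determined by $S$ up to a positive scalar multiple, which does not affect the number of distinct eigenvalues of $P$ nor the maps induced by $P$ and $O$.) *)

(* Defs.v *)
From HB Require Import structures.
From mathcomp Require Import all_boot all_order all_algebra.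
From mathcomp Require Import all_classical all_reals all_analysis.
From mathcomp Require Import measurable_realfun.
Set Implicit Arguments.
Unset Strict Implicit.
Unset Printing Implicit Defensive.
Import Order.TTheory GRing.Theory Num.Theory.
Import numFieldNormedType.Exports.
Local Open Scope classical_set_scope.
Local Open Scope ring_scope.

(* The library norm on 'cV[R]_m is the sup norm; [enorm] is the Euclidean one
   (both induce the same topology). *)
Definition dotp (R : realType) (m : nat) (u v : 'cV[R]_m) : R :=
  \sum_(i < m) u i 0 * v i 0.

Definition enorm (R : realType) (m : nat) (u : 'cV[R]_m) : R :=
  Num.sqrt (dotp u u).

Definition unit_sphere (R : realType) (n : nat) : set 'cV[R]_n.+1 :=
  [set p | enorm p = 1].

Arguments unit_sphere : clear implicits.

Definition sphere (R : realType) (n : nat) : Type :=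
  set_type (unit_sphere R n).

Definition sphere_val (R : realType) (n : nat) (p : sphere R n) :
  'cV[R]_n.+1 := set_val p.

HB.instance Definition _ (R : realType) (n : nat) :=
  Topological.copy (sphere R n) (set_type (unit_sphere R n)).

Section sphere_borel.
Variables (R : realType) (n : nat).

Lemma enormE (m : nat) (u : 'cV[R]_m) :
  enorm u = Num.sqrt (\sum_(i < m) u i 0 ^+ 2).
Proof. by congr Num.sqrt; apply: eq_bigr => i _; rewrite expr2. Qed.

Lemma enorm_ge0 (m : nat) (u : 'cV[R]_m) : 0 <= enorm u.
Proof. exact: sqrtr_ge0. Qed.

Lemma enormZ (m : nat) (a : R) (u : 'cV[R]_m) : enorm (a *: u) = `|a| * enorm u.
Proof.
rewrite !enormE -sqrtr_sqr -sqrtrM ?sqr_ge0// mulr_sumr.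
by congr Num.sqrt; apply: eq_bigr => i _; rewrite mxE exprMn.
Qed.

Lemma enorm_delta : enorm (delta_mx 0 0 : 'cV[R]_n.+1) = 1.
Proof.
rewrite enormE (bigD1 ord0)//= mxE !eqxx expr1n big1 ?addr0 ?sqrtr1// => i i0.
by rewrite mxE (negbTE i0) /= expr0n.
Qed.

Lemma enorm_normalize (u : 'cV[R]_n.+1) :
  enorm u != 0 -> enorm ((enorm u)^-1 *: u) = 1.
Proof.
by move=> u0; rewrite enormZ ger0_norm ?invr_ge0 ?enorm_ge0// mulVf.
Qed.

Definition mk_sphere (u : 'cV[R]_n.+1) (hu : enorm u = 1) : sphere R n :=
  SigSub (mem_set (hu : unit_sphere R n u)).

Lemma enorm_sphere (p : sphere R n) : enorm (sphere_val p) = 1.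
Proof. exact: (set_mem (valP p)). Qed.

HB.instance Definition _ :=
  isPointed.Build (sphere R n) (mk_sphere enorm_delta).

(* The sigma-algebra of [sphere R n] is the Borel one. *)
HB.instance Definition _ :=
  @isMeasurable.Build (sigma_display (@open (sphere R n))) (sphere R n)
    <<s @open (sphere R n) >>
    (@sigma_algebra0 _ setT _) (@sigma_algebraC _ _)
    (@sigma_algebra_bigcup _ setT _).

End sphere_borel.

Section lebesgue_tuple.
Variable R : realType.
Notation RT := (measurableTypeR R).

Definition tuple_cons (n : nat) (x : RT * n.-tuple RT) : n.+1.-tuple RT :=
  [tuple of x.1 :: x.2].

Definition tuple_uncons (n : nat) (x : n.+1.-tuple RT) : RT * n.-tuple RT :=
  (thead x, [tuple of behead x]).

Lemma tuple_consK (n : nat) : cancel (@tuple_cons n) (@tuple_uncons n).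
Proof.
case=> a t; rewrite /tuple_uncons /tuple_cons/= theadE.
by congr pair; exact: val_inj.
Qed.

Lemma measurable_tuple_cons (n : nat) : measurable_fun setT (@tuple_cons n).
Proof. exact: measurable_cons. Qed.

Lemma measurable_tuple_uncons (n : nat) : measurable_fun setT (@tuple_uncons n).
Proof.
apply/measurable_fun_pairP; split; first exact: measurable_tnth.
exact: measurable_behead.
Qed.

Section step.
Variables (n : nat) (mu : {sigma_finite_measure set (n.-tuple RT) -> \bar R}).

Definition lebesgue_step : set (n.+1.-tuple RT) -> \bar R :=
  pushforward (lebesgue_measure \x mu)%E (@tuple_cons n).

HB.instance Definition _ := Measure.copy lebesgue_step
  (measure_function_pushforward__canonical__measure_function_Measure
    (lebesgue_measure \x mu)%E (@measurable_tuple_cons n)).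

Lemma lebesgue_step_sigma_finite : sigma_finite setT lebesgue_step.
Proof.
have /sigma_finiteP[F [TF ndF Foo]] := sigma_finiteT (@lebesgue_measure R).
have /sigma_finiteP[G [TG ndG Goo]] := sigma_finiteT mu.
exists (fun k => @tuple_uncons n @^-1` (F k `*` G k)).
  rewrite -preimage_bigcup (_ : \bigcup_k _ = setT) ?preimage_setT//.
  rewrite -setXTT TF TG predeqE => -[x y]; split.
    by move=> [k _ []/= ? ?]; split; exists k.
  move=> [/= [i _ Fix] [k _ Gky]]; exists (maxn i k) => //; split.
  - by move: x Fix; exact/subsetPset/ndF/leq_maxl.
  - by move: y Gky; exact/subsetPset/ndG/leq_maxr.
move=> k; have [? ?] := Foo k; have [? ?] := Goo k; split.
  rewrite -[X in measurable X]setTI; apply: measurable_tuple_uncons => //.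
  exact: measurableX.
rewrite /lebesgue_step /pushforward -comp_preimage.
rewrite (_ : _ \o _ = id); last by apply/funext => x /=; rewrite tuple_consK.
by rewrite preimage_id product_measure1E// lte_mul_pinfty// ge0_fin_numE.
Qed.

HB.instance Definition _ := @Measure_isSigmaFinite.Build _ _ _ lebesgue_step
  lebesgue_step_sigma_finite.

End step.

(* Lebesgue measure on R^m, as an m-fold product measure. *)
Fixpoint lebesgue_tuple (m : nat) :
    {sigma_finite_measure set (m.-tuple RT) -> \bar R} :=
  match m with
  | 0%N => \d_([tuple] : 0.-tuple RT)
  | k.+1 => lebesgue_step (lebesgue_tuple k)
  end.

End lebesgue_tuple.

Lemma measurable_preimage_cV (R : realType) d (T : measurableType d) (m : nat)
    (f : T -> 'cV[R]_m) (U : set 'cV[R]_m) :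
  (forall i, measurable_fun setT (fun x => f x i 0)) ->
  open U -> measurable (f @^-1` U).
Proof.
move=> mf oU.
pose box (q : 'cV[rat]_m * nat) : set 'cV[R]_m :=
  [set x | forall i, ball (ratr (q.1 i 0) : R) q.2.+1%:R^-1 (x i 0)].
have mbox q : measurable (f @^-1` (box q)).
  have -> : f @^-1` (box q) = ~` \bigcup_(i : 'I_m)
      ((fun x => f x i 0) @^-1` ~` ball (ratr (q.1 i 0) : R) q.2.+1%:R^-1).
    apply/seteqP; split => [x bx [i _]|x nx i]; first by apply; exact: bx.
    by apply: contrapT => nb; apply: nx; exists i.
  apply: measurableC; apply: countable_bigcupT_measurable => // i.
  rewrite -[X in measurable X]setTI; apply: mf => //.
  by apply: measurableC; exact: measurable_ball.
have UE : U = \bigcup_q (if `[< box q `<=` U >] then box q else set0).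
  apply/seteqP; split => [x Ux|x [q _]]; last by case: asboolP => // qU /qU.
  have /nbhs_ballP[e /= e0 eU] : nbhs x U by exact: open_nbhs_nbhs.
  have [k ke] : exists k : nat, k.+1%:R^-1 < e / 2.
    have e20 : 0 < e / 2 by rewrite divr_gt0.
    by have [k _] := near_infty_natSinv_lt (PosNum e20); move/(_ k (leqnn k)); exists k.
  have k0 : 0 < k.+1%:R^-1 :> R by rewrite invr_gt0.
  have /choice[q qx] : forall i, exists q : rat,
      ratr q \in `](x i 0 - k.+1%:R^-1), (x i 0 + k.+1%:R^-1)[.
    by move=> i; apply: rat_in_itvoo; rewrite ltrBlDr -addrA ltrDl addr_gt0.
  have bx : box (\col_i q i, k) x.
    move=> i /=; rewrite mxE /ball/= ltr_norml.
    move: (qx i); rewrite in_itv/= => /andP[q1 q2].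
    by rewrite ltrBrDr ltrBlDl addrC q1 q2.
  exists (\col_i q i, k) => //; case: asboolP => // nU; exfalso; apply: nU.
  move=> y yb; apply: eU; split => // i j; rewrite (ord1 j).
  have := bx i; have := yb i; rewrite /ball/= => yi xi.
  rewrite (@lt_trans _ _ (k.+1%:R^-1 + k.+1%:R^-1))//; last first.
    by rewrite [ltRHS]splitr ltrD.
  by rewrite (le_lt_trans (ler_distD (ratr ((\col_i q i) i 0)) _ _))// ltrD// distrC.
rewrite UE preimage_bigcup; apply: countable_bigcupT_measurable => // q.
by case: ifP => _ //; rewrite preimage_set0.
Qed.

Section sphere_volume.
Variables (R : realType) (n : nat).
Notation RT := (measurableTypeR R).

Definition col_of_tuple (m : nat) (x : m.-tuple RT) : 'cV[R]_m :=
  \col_i tnth x i.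

(* The cone over [B] with vertex 0 (excluded), inside the unit ball. *)
Definition cone (B : set (sphere R n)) : set (n.+1.-tuple RT) :=
  [set x | exists r : R, exists p : sphere R n,
    [/\ 0 < r <= 1, B p & col_of_tuple x = r *: sphere_val p]].

(* Riemannian measure of the round sphere: in polar coordinates Lebesgue
   measure is r ^+ n dr dvol, so that the volume of the cone over [B] in the
   unit ball is vol B / (n + 1). *)
Definition sphere_vol (B : set (sphere R n)) : \bar R :=
  (n.+1%:R%:E * lebesgue_tuple R n.+1 (cone B))%E.

Lemma sphere_val_inj : injective (@sphere_val R n).
Proof. exact: val_inj. Qed.

Definition radial (x : n.+1.-tuple RT) : sphere R n :=
  match pselect (enorm (col_of_tuple x) != 0) with
  | left h => mk_sphere (enorm_normalize h)
  | right _ => point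
  end.

Lemma radial_val (x : n.+1.-tuple RT) : enorm (col_of_tuple x) != 0 ->
  sphere_val (radial x) = (enorm (col_of_tuple x))^-1 *: col_of_tuple x.
Proof. by rewrite /radial; case: pselect. Qed.

Lemma dotp_ge0 (m : nat) (u : 'cV[R]_m) : 0 <= dotp u u.
Proof. by apply: sumr_ge0 => i _; rewrite -expr2 sqr_ge0. Qed.

Lemma radialE (x : n.+1.-tuple RT) :
  sphere_val (radial x) =
  if dotp (col_of_tuple x) (col_of_tuple x) == 0 then delta_mx 0 0
  else dotp (col_of_tuple x) (col_of_tuple x) `^ (- 2^-1) *: col_of_tuple x.
Proof.
have [d0|d0] := eqVneq.
  by rewrite /radial; case: pselect => // h; case/negP: h; rewrite /enorm d0 sqrtr0.
rewrite radial_val ?powRN ?powR12_sqrt ?dotp_ge0//.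
by rewrite sqrtr_eq0 -ltNge lt_def d0 dotp_ge0.
Qed.

Definition sqr_enorm (x : n.+1.-tuple RT) : R :=
  dotp (col_of_tuple x) (col_of_tuple x).

Lemma measurable_coord (j : 'I_n.+1) :
  measurable_fun setT (fun x : n.+1.-tuple RT => tnth x j : R).
Proof. exact: measurable_tnth. Qed.

Lemma measurable_sqr_enorm : measurable_fun setT sqr_enorm.
Proof.
apply: measurable_sum => j; under eq_fun do rewrite !mxE.
by apply: measurable_funM; exact: measurable_coord.
Qed.

Lemma measurable_radial : measurable_fun setT radial.
Proof.
apply: (measurability (@open (sphere R n))) => //.
move=> _ [_ [V oV <-] <-]; rewrite setTI.
rewrite (_ : _ @^-1` _ = (fun x => sphere_val (radial x)) @^-1` V)//.
apply: measurable_preimage_cV => // i.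
under eq_fun do rewrite radialE (fun_if (fun u : 'cV_n.+1 => u i 0)).
apply: measurable_fun_ifT => //.
  apply: (measurable_fun_bool true).
  rewrite setTI (_ : _ @^-1` _ = sqr_enorm @^-1` [set 0]); last first.
    by apply/seteqP; split => x /= /eqP.
  by rewrite -[X in measurable X]setTI; exact: measurable_sqr_enorm.
under eq_fun do rewrite !mxE.
apply: measurable_funM; last exact: measurable_coord.
exact: (measurableT_comp (measurable_powR _) measurable_sqr_enorm).
Qed.

Definition punctured_ball : set (n.+1.-tuple RT) :=
  [set x | 0 < enorm (col_of_tuple x) <= 1].

Lemma measurable_punctured_ball : measurable punctured_ball.
Proof.
have -> : punctured_ball = sqr_enorm @^-1` `]0, 1].
  apply/funext => x; rewrite /punctured_ball/= in_itv/= sqrtr_gt0.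
  by rewrite -[in RHS](ler_sqrt _ ler01) sqrtr1.
by rewrite -[X in measurable X]setTI; exact: measurable_sqr_enorm.
Qed.

Lemma coneE (B : set (sphere R n)) : cone B = radial @^-1` B `&` punctured_ball.
Proof.
apply/seteqP; split => x.
  move=> [r [p [/andP[r0 r1] Bp xE]]].
  have nx : enorm (col_of_tuple x) = r.
    by rewrite xE enormZ enorm_sphere mulr1 gtr0_norm.
  split; last by rewrite /punctured_ball/= nx r0.
  rewrite /= (_ : radial x = p)//; apply: sphere_val_inj.
  by rewrite radial_val nx ?gt_eqF// xE scalerA mulVf ?scale1r// gt_eqF.
move=> [/= Bx /andP[x0 x1]].
exists (enorm (col_of_tuple x)), (radial x); split; rewrite ?x0//.
by rewrite radial_val ?gt_eqF// scalerA mulfV ?scale1r// gt_eqF.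
Qed.

Let vol_measure : {measure set (sphere R n) -> \bar R} :=
  mscale (n.+1%:R)%:nng
    (measure_function_pushforward__canonical__measure_function_Measure
      (mrestr (lebesgue_tuple R n.+1) measurable_punctured_ball)
      measurable_radial).

Let sphere_volE : sphere_vol = vol_measure.
Proof. by apply/funext => B; rewrite /sphere_vol coneE. Qed.

Let sphere_vol0 : sphere_vol set0 = 0%E.
Proof. by rewrite sphere_volE measure0. Qed.

Let sphere_vol_ge0 B : (0 <= sphere_vol B)%E.
Proof. by rewrite sphere_volE measure_ge0. Qed.

Let sphere_vol_sigma_additive : semi_sigma_additive sphere_vol.
Proof. by rewrite sphere_volE; exact: measure_semi_sigma_additive. Qed.

HB.instance Definition _ := isMeasure.Build _ _ _ sphere_vol
  sphere_vol0 sphere_vol_ge0 sphere_vol_sigma_additive.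

End sphere_volume.
Arguments sphere_vol : clear implicits.

Section optimal_transport.
Variables (R : realType) (n : nat).
Implicit Types (mu nu : set (sphere R n) -> \bar R).
Implicit Types (S T U : sphere R n -> sphere R n).
Local Notation vol := (sphere_vol R n).

(* Geodesic distance of the round metric: the angle between p and q. *)
Definition gdist (p q : sphere R n) : R :=
  acos (dotp (sphere_val p) (sphere_val q)).

Definition cost (p q : sphere R n) : R := 2^-1 * gdist p q ^+ 2.

Definition transports mu nu T : Prop :=
  measurable_fun setT T /\
  forall B : set (sphere R n), measurable B -> pushforward mu T B = nu B.

Definition optimal_map mu nu T : Prop :=
  transports mu nu T /\
  forall T', transports mu nu T' ->
    (\int[mu]_p (cost p (T p))%:E <= \int[mu]_p (cost p (T' p))%:E)%E.

Definition volume_preserving U : Prop := transports vol vol U.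

Definition brenier_mccann S T U : Prop :=
  [/\ volume_preserving U,
      optimal_map vol (pushforward vol S) T
    & {ae vol, forall p, S p = T (U p)}].

Definition projective_image (A : 'M[R]_n.+1) (p : sphere R n) : 'cV[R]_n.+1 :=
  (enorm (A *m sphere_val p))^-1 *: (A *m sphere_val p).

Definition induced_by (A : 'M[R]_n.+1) S : Prop :=
  forall p, sphere_val (S p) = projective_image A p.

(* "The" Brenier-McCann factorization of [S] is (P, O): there is one, and
   every one is given a.e. by P and O. *)
Definition factorizations_coincide S (P O : 'M[R]_n.+1) : Prop :=
  (exists T U, brenier_mccann S T U) /\
  forall T U, brenier_mccann S T U ->
    {ae vol, forall p, sphere_val (T p) = projective_image P p} /\
    {ae vol, forall p, sphere_val (U p) = O *m sphere_val p}.

End optimal_transport.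

Section matrices.
Variables (R : realType) (m : nat).

Definition positive_definite (P : 'M[R]_m) : Prop :=
  forall v : 'cV[R]_m, v != 0 -> 0 < dotp v (P *m v).

Definition self_adjoint (P : 'M[R]_m) : Prop := P^T = P.

Definition orthogonal_mx (O : 'M[R]_m) : Prop := O^T *m O = 1%:M.

Definition at_most_two_eigenvalues (P : 'M[R]_m) : Prop :=
  exists a b : R, forall c, eigenvalue P c -> c = a \/ c = b.

End matrices.

(* Main.v *)
(* If P has at most two eigenvalues a and b, then P = a Q + b (1 - Q) with Q an
   orthogonal projection, and p -> P p / |P p| moves p along a meridian of the
   join of two spheres: the colatitude t (cos t = |Q p|) becomes
   f t = arctan ((b / a) tan t). As d(p, T q) >= |t(p) - f(t(q))|, with equality
   for p = q, and f is increasing with primitive F, the function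
   t ^ 2 / 2 - F t is a potential for the cost; it shows that T is the unique
   optimal map, and then U = O by injectivity of T.

   If P has three eigenvalues, there is a plane with orthonormal basis u, v such
   that <u, P v> = 0, <P u, P v> > 0 and <u, P u> > <v, P v>. Along the great
   circle of that plane the circulation of the form <log_p T p, dp> is nonzero:
   <p, P p> takes the same value at the angles t and - t, whereas |P p| does
   not. Hence the points of a fine regular polygon on the circle violate cyclic
   monotonicity of T. The rotations permuting them preserve the volume, so
   composing T with such a rotation on the set where the cyclic cost sum can be
   lowered (an open set around the circle) gives a cheaper map: T is not
   optimal. *)

Require Import Defs.
From mathcomp Require Import all_boot all_order all_algebra.
From mathcomp Require Import all_classical all_reals all_analysis.
From mathcomp Require Import measurable_realfun spectral complex.
From mathcomp Require Import ring lra.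
Set Implicit Arguments.
Unset Strict Implicit.
Unset Printing Implicit Defensive.
Import Order.TTheory GRing.Theory Num.Theory.
Import numFieldNormedType.Exports.
Local Open Scope classical_set_scope.
Local Open Scope ring_scope.

(** * Linear algebra *)

(** Each condition on the plane serves one purpose: <u, P v> = 0 makes <p, P p> even in the angle,
    <P u, P v> > 0 makes |P p| fail to be even, and <u, P u> > <v, P v> gives <p, P p> a nonzero
    derivative along the circle. The values of the form at the angles t and - t then have a sum of
    constant sign, so the circulation need not be computed. When each of the N vertices of a polygon
    is sent to the image of its neighbour, the cost changes to first order by the form times the
    step, with an error of order 1 / N ^ 2 per vertex; the N errors together are beaten by the
    circulation for large N. The expansion must be uniform in the angle, so the cosine <p, T p> has
    to stay in a compact part of ]0, 1[: it is positive because P is positive definite, and below 1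
    because no point of the circle is an eigenvector. For two eigenvalues, uniqueness of the optimal
    map is not taken from a general theorem: it comes from the strict convexity of F and from the
    equality case of Cauchy-Schwarz in the two eigenspaces. *)

Section dot_product.
Context {R : realType} {m : nat}.
Implicit Types (u v w : 'cV[R]_m) (M : 'M[R]_m).

Lemma dotpC u v : dotp u v = dotp v u.
Proof. by apply: eq_bigr => i _; rewrite mulrC. Qed.

Lemma dotpDr u v w : dotp u (v + w) = dotp u v + dotp u w.
Proof. by rewrite -big_split; apply: eq_bigr => i _; rewrite mxE mulrDr. Qed.

Lemma dotpZr (c : R) u v : dotp u (c *: v) = c * dotp u v.
Proof. by rewrite mulr_sumr; apply: eq_bigr => i _; rewrite mxE mulrCA. Qed.

Lemma dotpDl u v w : dotp (u + v) w = dotp u w + dotp v w.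
Proof. by rewrite dotpC dotpDr !(dotpC w). Qed.

Lemma dotpZl (c : R) u v : dotp (c *: u) v = c * dotp u v.
Proof. by rewrite dotpC dotpZr dotpC. Qed.

Lemma dotpNr u v : dotp u (- v) = - dotp u v.
Proof. by rewrite -scaleN1r dotpZr mulN1r. Qed.

Lemma dotpNl u v : dotp (- u) v = - dotp u v.
Proof. by rewrite dotpC dotpNr dotpC. Qed.

Lemma dotpBr u v w : dotp u (v - w) = dotp u v - dotp u w.
Proof. by rewrite dotpDr dotpNr. Qed.

Lemma dotpBl u v w : dotp (u - v) w = dotp u w - dotp v w.
Proof. by rewrite dotpDl dotpNl. Qed.

Lemma dotp0r u : dotp u 0 = 0.
Proof. by apply: big1 => i _; rewrite mxE mulr0. Qed.

Lemma dotp_mulmx M u v : dotp u (M *m v) = dotp (M^T *m u) v.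
Proof.
rewrite /dotp; under eq_bigr do rewrite mxE mulr_sumr.
rewrite exchange_big /=; apply: eq_bigr => i _.
by rewrite mxE mulr_suml; apply: eq_bigr => j _; rewrite mxE; ring.
Qed.

Lemma dotp_symmx M u v : M^T = M -> dotp (M *m u) v = dotp u (M *m v).
Proof. by move=> sM; rewrite dotp_mulmx sM. Qed.

Lemma dotp_orthmx M u v :
  orthogonal_mx M -> dotp (M *m u) (M *m v) = dotp u v.
Proof. by move=> oM; rewrite dotp_mulmx mulmxA oM mul1mx. Qed.

Lemma dotp_eq0 u : (dotp u u == 0) = (u == 0).
Proof.
apply/idP/eqP => [|->]; last by rewrite dotp0r.
rewrite psumr_eq0 => [/allP h|i _]; last by rewrite -expr2 sqr_ge0.
apply/colP => i; have /implyP := h i (mem_index_enum _).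
by rewrite mxE -expr2 sqrf_eq0 => /(_ isT) /eqP.
Qed.

Lemma dotp_gt0 u : (0 < dotp u u) = (u != 0).
Proof. by rewrite lt_def dotp_ge0 dotp_eq0 andbT. Qed.

Lemma sqr_enormE u : enorm u ^+ 2 = dotp u u.
Proof. by rewrite sqr_sqrtr// dotp_ge0. Qed.

Lemma enorm_gt0 u : (0 < enorm u) = (u != 0).
Proof. by rewrite sqrtr_gt0 dotp_gt0. Qed.

Lemma enorm_orthmx M u : orthogonal_mx M -> enorm (M *m u) = enorm u.
Proof. by move=> oM; rewrite /enorm dotp_orthmx. Qed.

Lemma sqr_dotp_le u v : dotp u v ^+ 2 <= dotp u u * dotp v v.
Proof.
have [->|u0] := eqVneq u 0; first by rewrite dotpC !dotp0r expr0n mul0r.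
rewrite -dotp_gt0 in u0.
have := dotp_ge0 (dotp u u *: v - dotp u v *: u).
rewrite !(dotpBl, dotpBr, dotpZl, dotpZr) (dotpC v u) => h.
rewrite -subr_ge0 -(pmulr_rge0 _ u0).
apply: le_trans h _; rewrite le_eqVlt; apply/orP; left; apply/eqP; ring.
Qed.

Lemma dotp_le_enorm u v : dotp u v <= enorm u * enorm v.
Proof.
rewrite (le_trans (ler_norm _))// -sqrtr_sqr -sqrtrM ?dotp_ge0//.
by rewrite ler_sqrt ?mulr_ge0 ?dotp_ge0// sqr_dotp_le.
Qed.

End dot_product.

(** * Spectral projection for at most two eigenvalues *)

Section spectral.
Context {R : realType}.
Local Notation C := (complex R).

(* Diagonalize over C, where the spectral theorem is available. *)
Lemma selfadjoint_two_eigenvalues n (P : 'M[R]_n) (a b : R) :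
  self_adjoint P -> (forall c, eigenvalue P c -> c = a \/ c = b) ->
  (P - a%:M) *m (P - b%:M) = 0.
Proof.
move=> sP hab.
pose f := real_complex R : R -> C.
pose PC := map_mx f P.
have PCr : PC \is a realmx.
  apply/mxOverP => i j; rewrite mxE; apply/complex_realP; by exists (P i j).
have PCs : PC \is symmetricmx.
  apply/is_hermitianmxP; rewrite expr0 scale1r map_mx_id//.
  by rewrite /PC -[in LHS]sP; apply/matrixP => i j; rewrite !mxE.
have /orthomx_spectralP := symmetric_normalmx PCs PCr.
set Q := spectralmx PC; set d := spectral_diag PC => PCE.
have Qu : Q \in unitmx by exact: spectral_unit.
have QP : Q *m PC = diag_mx d *m Q by rewrite PCE !mulmxA mulmxV// mul1mx.
have dr : d \is a realmx by exact/hermitian_spectral_diag_real/realsym_hermsym.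
(* Row [i] of the invertible [Q] is a left eigenvector of [PC], and a real eigenvalue of [PC] is an
   eigenvalue of [P]. *)
have dab i : d 0 i = f a \/ d 0 i = f b.
  have /mxOverP/(_ 0 i)/complex_realP[x dx] := dr.
  have : eigenvalue PC (f x).
    apply/eigenvalueP; exists (row i Q).
      rewrite -row_mul QP; apply/rowP => j.
      by rewrite [LHS]mxE mul_diag_mx !mxE dx.
    apply: contraTneq Qu => Q0; rewrite unitmxE.
    rewrite (expand_det_row _ i) big1 ?unitr0// => j _.
    by move/rowP: Q0 => /(_ j); rewrite !mxE => ->; rewrite mul0r.
  by rewrite eigenvalue_map => /hab[] <-; [left|right].
have dd : (diag_mx d - (f a)%:M) *m (diag_mx d - (f b)%:M) = 0.
  apply/matrixP => i j; rewrite !mxE big1// => k _; rewrite !mxE.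
  have [->|ik] := eqVneq i k; last by rewrite !mulr0n subrr mul0r.
  have [_|kj] := eqVneq k j; last by rewrite !mulr0n subrr mulr0.
  by rewrite !mulr1n; case: (dab k) => ->; rewrite subrr ?mul0r ?mulr0.
have H c : PC - (f c)%:M = invmx Q *m (diag_mx d - (f c)%:M) *m Q.
  rewrite mulmxBr mulmxBl -PCE; congr (_ - _).
  by rewrite -scalemx1 -scalemxAr mulmx1 -scalemxAl mulVmx.
have : map_mx f ((P - a%:M) *m (P - b%:M)) = map_mx f 0.
  rewrite map_mxM !map_mxB !map_scalar_mx -/PC !H map_mx0.
  rewrite !mulmxA (mulmxK Qu) -(mulmxA (invmx Q)) dd.
  by rewrite mulmx0 mul0mx.
by move/matrixP => h; apply/matrixP => i j; have := h i j; rewrite !mxE; case.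
Qed.

(** [Q] is the Lagrange polynomial (P - b) / (a - b), idempotent because (P - a) (P - b) = 0. A
    nonzero vector in the image of P - b is an eigenvector for [a], whence [a > 0]; likewise for
    [b]. *)
Lemma two_eigenvalues_projection n (P : 'M[R]_n.+1) :
  self_adjoint P -> positive_definite P -> at_most_two_eigenvalues P ->
  exists (a b : R) (Q : 'M[R]_n.+1),
    [/\ 0 < a, 0 < b, Q^T = Q, Q *m Q = Q & P = a *: Q + b *: (1%:M - Q)].
Proof.
move=> sP pP [a [b hab]].
have PE := selfadjoint_two_eigenvalues sP hab.
(* A scalar [P] is treated apart: one of the given [a] and [b] may then be an arbitrary real, so
   both coefficients are set to the only eigenvalue. *)
have proj0 (c : R) : 0 < c -> P = c%:M -> exists (a b : R) (Q : 'M[R]_n.+1),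
    [/\ 0 < a, 0 < b, Q^T = Q, Q *m Q = Q & P = a *: Q + b *: (1%:M - Q)].
  move=> c0 Pc; exists c, c, 0; split => //; rewrite ?trmx0 ?mulmx0//.
  by rewrite scaler0 add0r subr0 scalemx1.
have gt0 (v : 'cV[R]_n.+1) c : v != 0 -> P *m v = c *: v -> 0 < c.
  move=> v0 Pv; have := pP _ v0; rewrite Pv dotpZr pmulr_lgt0//.
  by rewrite dotp_gt0.
have eq0 (M : 'M[R]_n.+1) : (forall v : 'cV_n.+1, M *m v = 0) -> M = 0.
  move=> h; apply/matrixP => i j.
  by have /colP/(_ i) := h (delta_mx j 0); rewrite -colE !mxE.
have nz (M : 'M[R]_n.+1) : M != 0 -> exists v : 'cV_n.+1, M *m v != 0.
  move=> M0; apply: contrapT => h; case/eqP: M0; apply: eq0 => v.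
  by apply/eqP/negPn/negP => hv; apply: h; exists v.
have comm c d : (P - c%:M) *m (P - d%:M) = (P - d%:M) *m (P - c%:M).
  rewrite !mulmxBl !mulmxBr -!scalar_mxM !mul_mx_scalar !mul_scalar_mx.
  by move: (P *m P) => Z; apply/matrixP => i j; rewrite !mxE; ring.
have one0 : const_mx 1 != 0 :> 'cV[R]_n.+1.
  by apply/eqP => /colP/(_ 0); rewrite !mxE => /eqP; rewrite oner_eq0.
have [/eqP|Na] := eqVneq (P - a%:M) 0.
  rewrite subr_eq0 => /eqP Pa; apply: (proj0 a) => //.
  by apply: (gt0 _ _ one0); rewrite Pa mul_scalar_mx.
have [/eqP|Nb] := eqVneq (P - b%:M) 0.
  rewrite subr_eq0 => /eqP Pb; apply: (proj0 b) => //.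
  by apply: (gt0 _ _ one0); rewrite Pb mul_scalar_mx.
have b0 : 0 < b.
  have [v v0] := nz _ Na; apply: (gt0 _ _ v0); apply/eqP.
  rewrite -subr_eq0 -mul_scalar_mx -mulmxBl mulmxA comm.
  by rewrite PE mul0mx.
have a0 : 0 < a.
  have [v v0] := nz _ Nb; apply: (gt0 _ _ v0); apply/eqP.
  by rewrite -subr_eq0 -mul_scalar_mx -mulmxBl mulmxA PE mul0mx.
(* If [a = b], the symmetric matrix P - a has square 0, hence vanishes, which [Na] excludes. *)
have [ab|ab] := eqVneq a b.
  exfalso; case/eqP: Na; apply: eq0 => v; apply/eqP; rewrite -dotp_eq0.
  rewrite dotp_mulmx linearB /= sP tr_scalar_mx mulmxA.
  by rewrite {2}ab PE mul0mx dotpC dotp0r.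
have ab0 : a - b != 0 by rewrite subr_eq0.
exists a, b, ((a - b)^-1 *: (P - b%:M)); split => //.
- by rewrite linearZ /= linearB /= sP tr_scalar_mx.
- rewrite -scalemxAl -scalemxAr; congr (_ *: _).
  have -> : (P - b%:M) = (P - a%:M) + (a - b)%:M.
    by rewrite raddfB /= addrA subrK.
  rewrite mulmxDr mul_mx_scalar scalerDr scalerA mulVf// scale1r.
  rewrite -[in X in _ *: X + _](_ : P - b%:M = P - a%:M + (a - b)%:M); last first.
    by rewrite raddfB /= addrA subrK.
  by rewrite comm PE scaler0 add0r.
- apply/matrixP => i j; rewrite !mxE.
  by case: (i == j); rewrite ?mulr1n ?mulr0n; field.
Qed.

End spectral.

(** * The plane of the circle along which optimality fails *)

Section conjugate_plane.
Context {R : realType}.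

(** Of three distinct eigenvalues an extreme one is named [a], so that [b - a] and [c - a] have the
    same sign. If [x] lies between [y] and [z], then [y] is extreme. *)
Lemma three_eigenvalues m (P : 'M[R]_m) : ~ at_most_two_eigenvalues P ->
  exists a b c, [/\ eigenvalue P a, eigenvalue P b, eigenvalue P c,
    b != c & 0 < (b - a) * (c - a)].
Proof.
move=> P3.
have out x y : exists z, [/\ eigenvalue P z, z != x & z != y].
  apply: contrapT => h; apply: P3; exists x, y => z ez.
  have [|zx] := eqVneq z x; first by left.
  by right; apply: contrapT => /eqP zy; apply: h; exists z.
have [x [ex _ _]] := out 0 0.
have [y [ey yx _]] := out x x.
have [z [ez zx zy]] := out x y.
have [h|h] := ltP 0 ((y - x) * (z - x)).
  by exists x, y, z; rewrite eq_sym.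
exists y, x, z; split => //; first by rewrite eq_sym.
have : 0 < (x - y) ^+ 2 by rewrite exprn_even_gt0//= subr_eq0 eq_sym.
by rewrite expr2; move: h; lra.
Qed.

(* In an orthonormal eigenbasis e1, e2, e3 with eigenvalues a, b, c, two vectors
   x and y satisfy <x, y> = <x, P y> = 0 as soon as the products x_i y_i are
   (b - c, c - a, a - b). *)
Lemma conjugate_plane n (P : 'M[R]_n.+1) :
  self_adjoint P -> ~ at_most_two_eigenvalues P ->
  exists u v : 'cV[R]_n.+1,
    [/\ dotp u u = 1, dotp v v = 1, dotp u v = 0, dotp u (P *m v) = 0 &
        0 < dotp (P *m u) (P *m v) * (dotp u (P *m u) - dotp v (P *m v))].
Proof.
move=> sP /three_eigenvalues[a [b [c [ea eb ec bc abc]]]].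
have eig x : eigenvalue P x ->
    exists e : 'cV[R]_n.+1, dotp e e = 1 /\ P *m e = x *: e.
  move=> /eigenvalueP[w wP w0].
  have w0' : w^T != 0 by rewrite -trmx0 (inj_eq trmx_inj).
  exists ((enorm w^T)^-1 *: w^T); rewrite -enorm_gt0 in w0'; split.
    rewrite dotpZl dotpZr -sqr_enormE; field; exact: lt0r_neq0.
  by rewrite -scalemxAr -[P in LHS]sP -trmx_mul wP linearZ /= scalerA mulrC -scalerA.
have orth x y e f : x != y -> P *m e = x *: e -> P *m f = y *: f ->
    dotp e f = 0 :> R.
  move=> xy Pe Pf; have : (x - y) * dotp e f = 0.
    by rewrite mulrBl -dotpZl -dotpZr -Pe -Pf dotp_symmx ?subrr.
  by move/eqP; rewrite mulf_eq0 subr_eq0 (negbTE xy) => /eqP.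
have [e1 [e11 Pe1]] := eig _ ea.
have [e2 [e22 Pe2]] := eig _ eb.
have [e3 [e33 Pe3]] := eig _ ec.
have ba : b != a by apply: contraTneq abc => ->; rewrite subrr mul0r ltxx.
have ca : c != a by apply: contraTneq abc => ->; rewrite subrr mulr0 ltxx.
have e12 := orth _ _ _ _ ba Pe2 Pe1.
have e13 := orth _ _ _ _ ca Pe3 Pe1.
have e23 := orth _ _ _ _ bc Pe2 Pe3.
pose comb x1 x2 x3 : 'cV[R]_n.+1 := x1 *: e1 + x2 *: e2 + x3 *: e3.
have Pcomb x1 x2 x3 : P *m comb x1 x2 x3 = comb (x1 * a) (x2 * b) (x3 * c).
  by rewrite /comb !mulmxDr -!scalemxAr Pe1 Pe2 Pe3 !scalerA.
have dcomb x1 x2 x3 y1 y2 y3 :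
    dotp (comb x1 x2 x3) (comb y1 y2 y3) = x1 * y1 + x2 * y2 + x3 * y3.
  rewrite /comb !(dotpDl, dotpDr, dotpZl, dotpZr).
  rewrite (dotpC e1 e2) (dotpC e1 e3) (dotpC e3 e2) e11 e22 e33 e12 e13 e23; ring.
(* The first coordinates of [x] and [y] can be scaled inversely. The equation excluded here is the
   one that would give [al = be] below; since [(b - a) * (c - a) > 0], it cannot hold at both t = 1
   and t = 2. *)
have [t t0 tP] : exists2 t : R, 0 < t &
    (b - a) * (c - a) * t ^+ 4 != (b - c) ^+ 2 * (t ^+ 2 + 1).
  have [h1|] := eqVneq ((b - a) * (c - a) * 1 ^+ 4) ((b - c) ^+ 2 * (1 ^+ 2 + 1)).
    exists 2 => //; apply/eqP => h2.
    move: h1 h2 abc; set p := (b - a) * (c - a); set q := (b - c) ^+ 2; lra.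
  by exists 1.
pose x := comb t 1 1.
pose y := comb ((b - c) / t) (c - a) (a - b).
have tn0 : t != 0 by rewrite gt_eqF.
have xx : 0 < dotp x x by rewrite dcomb; nra.
have yy : 0 < dotp y y.
  rewrite dcomb; have : 0 <= (b - c) / t * ((b - c) / t) by rewrite -expr2 sqr_ge0.
  have : 0 <= (a - b) * (a - b) by rewrite -expr2 sqr_ge0.
  have : 0 < (c - a) * (c - a) by rewrite -expr2 exprn_even_gt0//= subr_eq0.
  lra.
have xy : dotp x y = 0 by rewrite dcomb; field.
have xPy : dotp x (P *m y) = 0 by rewrite Pcomb dcomb; field.
have PxPy : dotp (P *m x) (P *m y) != 0.
  have -> : dotp (P *m x) (P *m y) = (a - b) * (b - c) * (a - c).
    by rewrite !Pcomb dcomb; field.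
  by rewrite mulf_neq0 ?mulf_neq0 ?(subr_eq0 a) ?(subr_eq0 b) ?(eq_sym a).
pose al := dotp x (P *m x) / dotp x x.
pose be := dotp y (P *m y) / dotp y y.
have albe : al - be != 0.
  rewrite subr_eq0 /al /be eqr_div ?(lt0r_neq0 xx) ?(lt0r_neq0 yy)// -subr_eq0 !Pcomb !dcomb.

  have -> : (t * (t * a) + 1 * (1 * b) + 1 * (1 * c)) *
     ((b - c) / t * ((b - c) / t) + (c - a) * (c - a) + (a - b) * (a - b)) -
     ((b - c) / t * ((b - c) / t * a) + (c - a) * ((c - a) * b) +
     (a - b) * ((a - b) * c)) * (t * t + 1 * 1 + 1 * 1) =
     - ((b - a) + (c - a)) * ((b - a) * (c - a) * t ^+ 4 -
       (b - c) ^+ 2 * (t ^+ 2 + 1)) / t ^+ 2 by field.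
  rewrite !mulf_neq0 ?invr_eq0 ?expf_neq0//; last by rewrite subr_eq0.
  rewrite oppr_eq0.
  apply: contraTneq abc => h; rewrite -leNgt.
  have -> : c - a = - (b - a) by lra.
  by rewrite mulrN oppr_le0 -expr2 sqr_ge0.
(* Replacing y by - y reverses <P x, P y> and leaves [al] and [be] unchanged, so the sign of the
   product is at one's disposal. *)
pose s : R := Num.sg (dotp (P *m x) (P *m y) * (al - be)).
have s1 : s * s = 1 by rewrite -expr2 sqr_sg mulf_neq0.
have [rx ry] : enorm x != 0 /\ enorm y != 0.
  by rewrite !gt_eqF// sqrtr_gt0.
exists ((enorm x)^-1 *: x), ((s / enorm y) *: y); split.
- rewrite dotpZl dotpZr -sqr_enormE; field; exact: rx.
- rewrite dotpZl dotpZr -sqr_enormE.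
  by transitivity (s * s); first by field.
- by rewrite dotpZl dotpZr xy !mulr0.
- by rewrite -scalemxAr dotpZl dotpZr xPy !mulr0.
- rewrite -!scalemxAr !(dotpZl, dotpZr).
  rewrite [X in _ * (X - _)](_ : _ = al); last first.
    by rewrite /al -sqr_enormE; field.
  rewrite [X in _ * (_ - X)](_ : _ = be); last first.
    rewrite /be -sqr_enormE.
    transitivity (s * s * dotp y (P *m y) / enorm y ^+ 2); first by field.
    by rewrite s1 mul1r.
  have -> : (enorm x)^-1 * (s / enorm y * dotp (P *m x) (P *m y)) * (al - be) =
    (enorm x)^-1 * (enorm y)^-1 * (s * (dotp (P *m x) (P *m y) * (al - be))) by ring.
  rewrite -normrEsg !mulr_gt0 ?invr_gt0 ?normr_gt0 ?mulf_neq0//.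
    by rewrite lt_def rx enorm_ge0.
  by rewrite lt_def ry enorm_ge0.
Qed.

End conjugate_plane.

(** * Orthogonal invariance of Lebesgue measure *)

Notation pushforward_measure mu mf :=
  (measure_function_pushforward__canonical__measure_function_Measure mu mf).

Lemma product_measure_preserving d1 d2 (T1 : measurableType d1)
    (T2 : measurableType d2) (R : realType)
    (m1 : {sigma_finite_measure set T1 -> \bar R})
    (m2 : {sigma_finite_measure set T2 -> \bar R}) (f : T1 -> T1) (g : T2 -> T2) :
  measurable_fun setT f -> measurable_fun setT g ->
  (forall A, measurable A -> m1 (f @^-1` A) = m1 A) ->
  (forall A, measurable A -> m2 (g @^-1` A) = m2 A) ->
  forall A, measurable A ->
    (m1 \x m2)%E ((fun x => (f x.1, g x.2)) @^-1` A) = (m1 \x m2)%E A.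
Proof.
move=> mf mg fE gE A mA.
have mfg : measurable_fun setT (fun x : T1 * T2 => (f x.1, g x.2)).
  apply/measurable_fun_pairP; split; first exact: measurableT_comp mf _.
  exact: measurableT_comp mg _.
rewrite [RHS](product_measure_unique
  (m' := pushforward_measure (m1 \x m2)%E mfg)) // => B C mB mC.
transitivity ((m1 \x m2)%E ((f @^-1` B) `*` (g @^-1` C))) => //.
rewrite product_measure1E; first by congr (_ * _)%E; [exact: fE|exact: gE].
- by rewrite -[X in measurable X]setTI; exact: mf.
- by rewrite -[X in measurable X]setTI; exact: mg.
Qed.

Section tuple_lebesgue.
Context {R : realType}.
Notation RT := (measurableTypeR R).
Local Notation lam n := (lebesgue_tuple R n).

Definition tuple_of_col n (u : 'cV[R]_n) : n.-tuple RT :=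
  [tuple u i 0 | i < n].

Lemma tuple_of_colK n : cancel (@tuple_of_col n) (@col_of_tuple R n).
Proof. by move=> u; apply/colP => i; rewrite mxE tnth_mktuple. Qed.

Lemma measurable_tuple_of_col d (T : measurableType d) n (f : T -> 'cV[R]_n) :
  (forall i, measurable_fun setT (fun x => f x i 0)) ->
  measurable_fun setT (@tuple_of_col n \o f).
Proof.
move=> mf; apply/measurable_fun_tnthP => i.
rewrite [X in measurable_fun _ X](_ : _ = fun x => f x i 0); first exact: mf.
by apply/funext => x; rewrite /= tnth_mktuple.
Qed.

Lemma tnth_behead_lift (T : Type) n (t : n.+1.-tuple T) (i : 'I_n) :
  tnth [tuple of behead t] i = tnth t (lift ord0 i).
Proof. by case/tupleP: t => x t; rewrite tnthS; congr tnth; exact: val_inj. Qed.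

Definition shift_tuple n (a t : n.-tuple RT) : n.-tuple RT :=
  [tuple (tnth a i : R) + (tnth t i : R) | i < n].

Lemma measurable_shift_tuple n (a : n.-tuple RT) :
  measurable_fun setT (shift_tuple a).
Proof.
apply/measurable_fun_tnthP => i.
rewrite [X in measurable_fun _ X](_ : _ =
    fun t => (tnth a i : R) + (tnth t i : R)); last first.
  by apply/funext => t; rewrite /= tnth_mktuple.
by apply: measurable_funD => //; exact: measurable_tnth.
Qed.

Lemma lebesgue_measure_shift (a : R) (A : set RT) : measurable A ->
  lebesgue_measure ((fun x : RT => a + x : RT) @^-1` A) = lebesgue_measure A.
Proof.
have ms : measurable_fun setT (fun x : RT => a + x : RT).
  exact: measurable_funD.
move=> mA; apply/esym.
apply: (lebesgue_measure_unique (mu := pushforward_measure lebesgue_measure ms)).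
  move=> _ [[x y]] _ <-; rewrite /= /pushforward.
  rewrite (_ : _ @^-1` _ = `](x - a), (y - a)]%classic); last first.
    apply/seteqP; split => z /=; rewrite !in_itv/= => /andP[? ?]; lra.
  rewrite !lebesgue_measure_itv/= !lte_fin ltrD2r.
  by case: ifP => // _; rewrite -!EFinB; congr EFin; ring.
by [].
Qed.

Lemma lebesgue_tuple_shift n (a : n.-tuple RT) (A : set (n.-tuple RT)) :
  measurable A -> lam n (shift_tuple a @^-1` A) = lam n A.
Proof.
elim: n a A => [|n IHn] a A mA.
  rewrite (_ : shift_tuple a = id) ?preimage_id//.
  by apply/funext => t; rewrite (tuple0 t) tuple0.
pose f (x : RT) : RT := (thead a : R) + x.
pose g := shift_tuple [tuple of behead a].
rewrite /= /lebesgue_step /pushforward.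
rewrite (_ : _ @^-1` _ = (fun x => (f x.1, g x.2)) @^-1` (@tuple_cons R n @^-1` A)).
  apply: product_measure_preserving => //.
  - exact: measurable_funD.
  - exact: measurable_shift_tuple.
  - by move=> B mB; exact: lebesgue_measure_shift.
  - by move=> B mB; exact: IHn.
  - by rewrite -[X in measurable X]setTI; exact: measurable_tuple_cons.
have tE (x : RT * n.-tuple RT) :
    shift_tuple a (tuple_cons x) = tuple_cons (f x.1, g x.2).
  apply: eq_from_tnth => i.
  rewrite tnth_mktuple; case: (unliftP ord0 i) => [j|] ->.
    by rewrite !tnthS tnth_mktuple tnth_behead_lift.
  by rewrite !tnth0.
by apply/seteqP; split => x /=; rewrite tE.
Qed.

Definition cube n (a : n.-tuple RT) (r : R) : set (n.-tuple RT) :=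
  [set t | forall i, (tnth a i : R) - r <= tnth t i <= (tnth a i : R) + r].

Lemma measurable_cube n (a : n.-tuple RT) (r : R) : measurable (cube a r).
Proof.
have -> : cube a r = ~` \bigcup_(i : 'I_n) ((fun t : n.-tuple RT => tnth t i)
    @^-1` ~` `[(tnth a i : R) - r, (tnth a i : R) + r]).
  apply/seteqP; split => [t h [i _]|t h i].
    by apply; rewrite /= in_itv/=; exact: h.
  by apply: contrapT => nh; apply: h; exists i => //=; rewrite in_itv.
apply: measurableC; apply: countable_bigcupT_measurable => // i.
rewrite -[X in measurable X]setTI; apply: measurable_tnth => //.
by apply: measurableC; exact: measurable_itv.
Qed.

Lemma lebesgue_tuple_cube n (a : n.-tuple RT) (r : R) : 0 <= r ->
  lam n (cube a r) = ((2 * r) ^+ n)%:E.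
Proof.
move=> r0; elim: n a => [|n IHn] a.
  by rewrite expr0 /= diracE mem_set//= => -[].
rewrite /= /lebesgue_step /pushforward.
rewrite (_ : _ @^-1` _ = `[(thead a : R) - r, (thead a : R) + r]%classic `*`
  cube [tuple of behead a] r); last first.
  apply/seteqP; split => -[x t] /= H.
    split; first by have := H ord0; rewrite !tnth0 in_itv.
    by move=> i; have := H (lift ord0 i); rewrite tnthS tnth_behead_lift.
  move=> i; case: (unliftP ord0 i) => [j|] ->.
    by have := H.2 j; rewrite tnthS tnth_behead_lift.
  by have := H.1; rewrite !tnth0 in_itv.
rewrite product_measure1E; [|exact: measurable_itv|exact: measurable_cube].
rewrite exprS EFinM; congr (_ * _)%E; last exact: IHn.
rewrite [LHS]lebesgue_measure_itv/= lte_fin.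
case: ltP => h; first by rewrite -EFinB; congr EFin; ring.
by congr EFin; lra.
Qed.

Definition mulmx_tuple n (M : 'M[R]_n) (t : n.-tuple RT) : n.-tuple RT :=
  tuple_of_col (M *m col_of_tuple t).

Lemma measurable_mulmx_tuple n (M : 'M[R]_n) :
  measurable_fun setT (mulmx_tuple M).
Proof.
apply: (@measurable_tuple_of_col _ _ _ (fun t => M *m col_of_tuple t)) => i.
rewrite [X in measurable_fun _ X](_ : _ =
    fun t : n.-tuple RT => \sum_j M i j * (tnth t j : R)); last first.
  by apply/funext => t; rewrite mxE; apply: eq_bigr => j _; rewrite mxE.
apply: measurable_sum => j; apply: measurable_funM => //.
exact: measurable_tnth.
Qed.

Definition tuple_ball n : set (n.-tuple RT) :=
  [set t | dotp (col_of_tuple t) (col_of_tuple t) <= 1].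

Lemma measurable_tuple_ball n : measurable (@tuple_ball n).
Proof.
rewrite (_ : @tuple_ball n =
    (fun t => dotp (col_of_tuple t) (col_of_tuple t)) @^-1` `]-oo, 1]); last first.
  by apply/seteqP; split => t /=; rewrite in_itv.
rewrite -[X in measurable X]setTI.
have : measurable_fun setT
    (fun t : n.-tuple RT => dotp (col_of_tuple t) (col_of_tuple t)).
  apply: measurable_sum => j; under eq_fun do rewrite mxE.
  by apply: measurable_funM; exact: measurable_tnth.
by apply => //; exact: measurable_itv.
Qed.

Let ball0 (x r : R) : (0 - r <= x <= 0 + r) = (`|x| <= r).
Proof. by rewrite -ler_distl subr0. Qed.

Lemma tuple_ball_cube n :
  @tuple_ball n `<=` cube [tuple of nseq n (0 : RT)] 1.
Proof.
move=> t /= t1 i; rewrite tnth_nseq.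
rewrite (_ : _ && _ = (`|tnth t i : R| <= 1)); last exact: ball0.
rewrite -[leRHS](sqrtr1) -sqrtr_sqr ler_sqrt//.
apply: le_trans t1; rewrite /dotp (bigD1 i)//= !mxE -expr2 lerDl.
by apply: sumr_ge0 => j _; rewrite -expr2 sqr_ge0.
Qed.

Lemma lebesgue_tuple_ball_fin n : (lam n (@tuple_ball n) < +oo)%E.
Proof.
apply: (@le_lt_trans _ _ (lam n (cube [tuple of nseq n (0 : RT)] 1))).
  apply: le_measure; rewrite ?inE; first exact: measurable_tuple_ball.
    exact: measurable_cube.
  exact: tuple_ball_cube.
by rewrite lebesgue_tuple_cube ?ltry.
Qed.

Lemma lebesgue_tuple_ball_gt0 n : (0 < lam n (@tuple_ball n))%E.
Proof.
(* In this cube each squared coordinate is at most 1 / (n + 1), so the sum of the n of them is at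
   most 1. Taking n + 1 rather than n covers dimension 0. *)
apply: (@lt_le_trans _ _ (lam n (cube [tuple of nseq n (0 : RT)] n.+1%:R^-1))).
  by rewrite lebesgue_tuple_cube ?invr_ge0// lte_fin exprn_gt0// mulr_gt0// invr_gt0.
apply: le_measure; rewrite ?inE; first exact: measurable_cube.
  exact: measurable_tuple_ball.
move=> t ht; rewrite /tuple_ball /= /dotp.
apply: (@le_trans _ _ (\sum_(i < n) n.+1%:R^-1)).
  apply: ler_sum => i _; rewrite !mxE.
  have := ht i; rewrite tnth_nseq.
  rewrite (_ : _ && _ = (`|tnth t i : R| <= n.+1%:R^-1)); last exact: ball0.
  move=> h.
  rewrite -expr2 -real_normK ?num_real//.
  rewrite (@le_trans _ _ (n.+1%:R^-1 ^+ 2))//.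
    by rewrite ler_sqr ?nnegrE ?invr_ge0// normr_ge0.
  by rewrite expr2 ler_piMr ?invr_ge0// invf_le1// ler1n.
rewrite sumr_const card_ord -[leLHS]mulr_natl ler_pdivrMr// mul1r ler_nat.
exact: leqnSn.
Qed.

End tuple_lebesgue.

Section orthogonal_invariance.
Context {R : realType}.
Notation RT := (measurableTypeR R).
Local Notation lam n := (lebesgue_tuple R n).

Lemma product_measure12 n (X : set (n.-tuple RT * n.-tuple RT)) :
  measurable X -> (lam n \x lam n)%E X = (lam n \x^ lam n)%E X.
Proof.
by apply: product_measure_unique => B C mB mC; exact: product_measure2E.
Qed.

(* Fubini for {(x, y) | x in the ball, x + O y in A}: the x-sections are
   translates of the preimage of A under O, and the y-sections are those of
   {(z, y) | z in A, z - O y in the ball}, whose x-sections are translates of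
   the ball. *)
Lemma lebesgue_tuple_orthogonal n (M : 'M[R]_n) (A : set (n.-tuple RT)) :
  orthogonal_mx M -> measurable A ->
  lam n (mulmx_tuple M @^-1` A) = lam n A.
Proof.
move=> oM mA.
pose D := @tuple_ball R n.
have mD : measurable D by exact: measurable_tuple_ball.
have mMA : measurable (mulmx_tuple M @^-1` A).
  by rewrite -[X in measurable X]setTI; exact: measurable_mulmx_tuple.
have MMT : M *m M^T = 1%:M by exact: mulmx1C.
pose f (p : n.-tuple RT * n.-tuple RT) := shift_tuple p.1 (mulmx_tuple M p.2).
pose g (p : n.-tuple RT * n.-tuple RT) :=
  shift_tuple p.1 (mulmx_tuple (- M) p.2).
have mfg (N : 'M[R]_n) : measurable_fun setT
    (fun p : n.-tuple RT * n.-tuple RT => shift_tuple p.1 (mulmx_tuple N p.2)).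
  apply/measurable_fun_tnthP => i.
  rewrite [X in measurable_fun _ X](_ : _ =
      fun p => (tnth p.1 i : R) + (tnth (mulmx_tuple N p.2) i : R)); last first.
    by apply/funext => p; rewrite /= tnth_mktuple.
  apply: measurable_funD.
    exact: measurableT_comp (measurable_tnth i) measurable_fst.
  exact: measurableT_comp (measurable_tnth i)
    (measurableT_comp (measurable_mulmx_tuple N) measurable_snd).
pose C1 := [set p | D p.1 /\ A (f p)].
pose C2 := [set p | A p.1 /\ D (g p)].
have mC1 : measurable C1.
  apply: measurableI; rewrite -[X in measurable X]setTI.
    exact: measurable_fst.
  exact: mfg.
have mC2 : measurable C2.
  apply: measurableI; rewrite -[X in measurable X]setTI.
    exact: measurable_fst.
  exact: mfg.
have C12 : (lam n \x^ lam n)%E C1 = (lam n \x^ lam n)%E C2.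
  apply: eq_integral => y _ /=.
  rewrite -[RHS](lebesgue_tuple_shift (mulmx_tuple M y)); last exact: measurable_ysection.
  congr (lam n _); apply/seteqP.
  have gE x : g (shift_tuple (mulmx_tuple M y) x, y) = x.
    apply: eq_from_tnth => i; rewrite !tnth_mktuple mulNmx [X in _ + X]mxE.
    exact: (etrans (addrAC _ _ _) (etrans (congr1 (+%R^~ _) (subrr _)) (add0r _))).
  have fE x : f (x, y) = shift_tuple (mulmx_tuple M y) x.
    by apply: eq_from_tnth => i; rewrite !tnth_mktuple addrC.
  by split => x /=; rewrite !ysectionE /= /C1 /C2/= fE gE => -[].
have xC1 x : lam n (xsection C1 x) =
    ((fun=> lam n (mulmx_tuple M @^-1` A)) \_ D) x.
  rewrite patchE; case: ifPn => [|/negP]; rewrite inE => Dx; last first.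
    by rewrite (_ : xsection C1 x = set0) ?measure0// -subset0 => y /xsectionP[].
  rewrite -[RHS](lebesgue_tuple_shift (mulmx_tuple M^T x))//.
  congr (lam n _); apply/seteqP.
  have fE y : f (x, y) = mulmx_tuple M (shift_tuple (mulmx_tuple M^T x) y).
    have cE : col_of_tuple (shift_tuple (mulmx_tuple M^T x) y) =
        M^T *m col_of_tuple x + col_of_tuple y.
      by apply/colP => i; rewrite !mxE !tnth_mktuple mxE.
    apply: eq_from_tnth => i; rewrite !tnth_mktuple cE mulmxDr mulmxA MMT mul1mx.
    by rewrite [in RHS]mxE [in RHS]mxE.
  split => y; rewrite xsectionE /= /C1/= fE; first by case.
  by split.
have xC2 x : lam n (xsection C2 x) = ((fun=> lam n D) \_ A) x.
  rewrite patchE; case: ifPn => [|/negP]; rewrite inE => Ax; last first.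
    by rewrite (_ : xsection C2 x = set0) ?measure0// -subset0 => y /xsectionP[].
  rewrite -[RHS](lebesgue_tuple_shift (mulmx_tuple (- M^T) x))//.
  congr (lam n _); apply/seteqP.
  (* As [M] preserves the norm, x - M y lies in the ball if and only if y - M^T x does. *)
  have DE y : D (g (x, y)) = D (shift_tuple (mulmx_tuple (- M^T) x) y).
    have cE : col_of_tuple (shift_tuple (mulmx_tuple (- M^T) x) y) =
        - (M^T *m col_of_tuple x) + col_of_tuple y.
      by apply/colP => i; rewrite !mxE !tnth_mktuple mulNmx !mxE.
    have gE : col_of_tuple (g (x, y)) =
        - (M *m (- (M^T *m col_of_tuple x) + col_of_tuple y)).
      rewrite mulmxDr mulmxN mulmxA MMT mul1mx opprD opprK.
      apply/colP => i.
      by rewrite mxE tnth_mktuple tnth_mktuple mulNmx !mxE.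
    by rewrite /D /tuple_ball /= cE gE dotpNl dotpNr opprK dotp_orthmx.
  split => y; rewrite xsectionE /= /C2/= DE; first by case.
  by split.
have : (lam n \x lam n)%E C1 = (lam n \x lam n)%E C2.
  by rewrite !product_measure12.
rewrite /product_measure1.
rewrite (eq_integral _ _ (fun x _ => xC1 x)) (eq_integral _ _ (fun x _ => xC2 x)).
rewrite -!integral_mkcond (integral_cst _ mD) (integral_cst _ mA).
(* The ball now enters only through its measure, a positive real, which can be cancelled even when
   [A] has infinite measure. *)
have [r r0 rE] : exists2 r : R, 0 < r & lam n D = r%:E.
  have Dfin : lam n D \is a fin_num.
    by rewrite ge0_fin_numE//; exact: lebesgue_tuple_ball_fin.
  exists (fine (lam n D)); last by rewrite fineK.
  by rewrite -lte_fin fineK//; exact: lebesgue_tuple_ball_gt0.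
move=> h; have : (lam n (mulmx_tuple M @^-1` A) * r%:E = lam n A * r%:E)%E.
  by rewrite -rE; exact: etrans h (muleC _ _).
move=> /(congr1 (fun x => x * r^-1%:E)%E).
by rewrite -!muleA -EFinM mulfV ?gt_eqF// !mule1.
Qed.

End orthogonal_invariance.

(** * Maps of the sphere and its volume *)

Section acos_monotone.
Context {R : realType}.
Implicit Types x y : R.

Lemma lt_acos x y : -1 <= x -> x < y -> y <= 1 -> acos y < acos x.
Proof.
move=> x1 xy y1.
have xB : -1 <= x <= 1 by rewrite x1 (le_trans (ltW xy)).
have yB : -1 <= y <= 1 by rewrite y1 (le_trans x1 (ltW xy)).
rewrite -ltr_cos ?in_itv/= ?acos_ge0 ?acos_lepi//.
by rewrite !acosK ?in_itv.
Qed.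

Lemma le_acos x y : -1 <= x -> x <= y -> y <= 1 -> acos y <= acos x.
Proof.
by move=> x1; rewrite le_eqVlt => /predU1P[-> //|xy y1]; exact/ltW/lt_acos.
Qed.

Lemma measurable_acos_comp d (T : measurableType d) (f : T -> R) :
  (forall t, -1 <= f t <= 1) -> measurable_fun setT f ->
  measurable_fun setT (fun t => acos (f t)).
Proof.
(* Clipping the argument to [-1, 1] makes [acos] nonincreasing on the whole line, hence
   measurable. *)
move=> f1 mf; pose clip x : R := Num.max (-1) (Num.min 1 x).
have clip1 x : -1 <= clip x <= 1.
  rewrite /clip le_max lexx/= ge_max ge_min lexx /= andbT; lra.
have mclip : measurable_fun setT (fun x : R => acos (clip x)).
  apply: nonincreasing_measurable => // x y xy; apply: le_acos.
  - by case/andP: (clip1 x).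
  - by apply: le_max2 => //; apply: le_min2.
  - by case/andP: (clip1 y).
rewrite (_ : (fun t => acos (f t)) = (fun x : R => acos (clip x)) \o f).
  exact: measurableT_comp.
apply/funext => t /=; rewrite /clip; case/andP: (f1 t) => h1 h2.
by rewrite min_r// max_r.
Qed.

End acos_monotone.

Section coordinatewise_convergence.
Context {R : realType} {T : Type} {F : set_system T} {FF : Filter F}.

Lemma cvg_dotp m (f g : T -> 'cV[R]_m) (a b : 'cV[R]_m) :
  (forall i, f x i 0 @[x --> F] --> a i 0) ->
  (forall i, g x i 0 @[x --> F] --> b i 0) ->
  dotp (f x) (g x) @[x --> F] --> dotp a b.
Proof.
move=> fa gb; apply: cvg_big => [|i _]; first exact: add_continuous.
exact: cvgM.
Qed.

Lemma cvg_mulmx_coord m (M : 'M[R]_m) (f : T -> 'cV[R]_m) (a : 'cV[R]_m) i :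
  (forall i, f x i 0 @[x --> F] --> a i 0) ->
  (M *m f x) i 0 @[x --> F] --> (M *m a) i 0.
Proof.
move=> fa; under eq_fun do rewrite mxE; rewrite mxE.
apply: cvg_big => [|j _]; first exact: add_continuous.
by apply: cvgM => //; exact: cvg_cst.
Qed.

Lemma cvg_enorm m (f : T -> 'cV[R]_m) (a : 'cV[R]_m) :
  (forall i, f x i 0 @[x --> F] --> a i 0) ->
  enorm (f x) @[x --> F] --> enorm a.
Proof.
move=> fa; apply: (@cvg_comp _ _ _ (fun x => dotp (f x) (f x)) Num.sqrt).
  exact: cvg_dotp.
exact: sqrt_continuous.
Qed.

End coordinatewise_convergence.

Section sphere_maps.
Context {R : realType} {n : nat}.
Notation RT := (measurableTypeR R).
Notation sph := (sphere R n).
Notation vol := (sphere_vol R n).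
Implicit Types (p q : sph) (M : 'M[R]_n.+1).

Lemma dotp_sphere p : dotp (sphere_val p) (sphere_val p) = 1.
Proof. by rewrite -sqr_enormE enorm_sphere expr1n. Qed.

Lemma sphere_val_neq0 p : sphere_val p != 0.
Proof. by rewrite -dotp_gt0 dotp_sphere. Qed.

Lemma dotp_sphere_itv p q : -1 <= dotp (sphere_val p) (sphere_val q) <= 1.
Proof.
rewrite -ler_norml -[leRHS]sqrtr1 -sqrtr_sqr ler_sqrt//.
by rewrite (le_trans (sqr_dotp_le _ _))// !dotp_sphere mulr1.
Qed.

Lemma cost_ge0 p q : 0 <= cost p q.
Proof. by rewrite mulr_ge0 ?sqr_ge0// invr_ge0. Qed.

Lemma cost_le p q : cost p q <= pi ^+ 2.
Proof.
rewrite /cost ler_pdivrMl//; apply: (@le_trans _ _ (pi ^+ 2)).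
  by rewrite ler_sqr ?nnegrE ?pi_ge0 ?acos_ge0 ?acos_lepi ?dotp_sphere_itv.
by rewrite ler_peMl ?sqr_ge0// ler1n.
Qed.

Lemma sphere_val_continuous : continuous (@sphere_val R n).
Proof. exact: initial_continuous. Qed.

Lemma measurable_sphere_coord i :
  measurable_fun setT (fun p : sph => sphere_val p i 0).
Proof.
apply: (measurability _ (RGenOpens.measurableE R)) => _ [_ [a [b ->]] <-].
rewrite setTI; apply: sub_sigma_algebra.
apply: (open_comp (f := fun p : sph => sphere_val p i 0)) => [p _|].
  apply: (@continuous_comp _ _ _ (@sphere_val R n) (fun u => u i 0)).
    exact: sphere_val_continuous.
  exact: coord_continuous.
exact: interval_open.
Qed.

Lemma measurable_to_sphere d (T : measurableType d) (f : T -> sph) :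
  (forall i, measurable_fun setT (fun x => sphere_val (f x) i 0)) ->
  measurable_fun setT f.
Proof.
move=> mf; apply: (measurability (@open sph)) => //.
move=> _ [_ [V oV <-] <-]; rewrite setTI.
rewrite (_ : _ @^-1` _ = (fun x => sphere_val (f x)) @^-1` V)//.
exact: measurable_preimage_cV.
Qed.

Lemma measurable_dotp d (T : measurableType d) m (f g : T -> 'cV[R]_m) :
  (forall i, measurable_fun setT (fun x => f x i 0)) ->
  (forall i, measurable_fun setT (fun x => g x i 0)) ->
  measurable_fun setT (fun x => dotp (f x) (g x)).
Proof.
by move=> mf mg; apply: measurable_sum => i; apply: measurable_funM.
Qed.

Lemma measurable_cost d (T : measurableType d) (f g : T -> sph) :
  measurable_fun setT f -> measurable_fun setT g ->
  measurable_fun setT (fun x => cost (f x) (g x)).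
Proof.
move=> mf mg; apply: measurable_funM => //; apply: measurable_funX.
apply: measurable_acos_comp => [t|]; first exact: dotp_sphere_itv.
by apply: measurable_dotp => i;
  exact: measurableT_comp (measurable_sphere_coord i) _.
Qed.

(** Going through [radial] gives a total map, with a default point where [M] kills [p], and
    measurability for every [M]. *)
Definition linear_image M p : sph := radial (tuple_of_col (M *m sphere_val p)).

Lemma linear_imageE M p : M *m sphere_val p != 0 ->
  sphere_val (linear_image M p) = projective_image M p.
Proof.
move=> Mp; rewrite /linear_image radial_val tuple_of_colK//.
by rewrite gt_eqF// enorm_gt0.
Qed.

Lemma measurable_linear_image M : measurable_fun setT (linear_image M).
Proof.
apply: measurableT_comp; first exact: measurable_radial.
apply: (measurable_tuple_of_col (f := fun p => M *m sphere_val p)) => i.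
rewrite [X in measurable_fun _ X](_ : _ =
    fun p : sph => \sum_j M i j * sphere_val p j 0); last first.
  by apply/funext => p; rewrite mxE.
apply: measurable_sum => j; apply: measurable_funM => //.
exact: measurable_sphere_coord.
Qed.

Lemma measurable_cone (B : set sph) : measurable B -> measurable (cone B).
Proof.
move=> mB; rewrite coneE; apply: measurableI.
  by rewrite -[X in measurable X]setTI; exact: measurable_radial.
exact: measurable_punctured_ball.
Qed.

(** The radial projection commutes with [M] and the punctured ball is invariant, so the cone over
    the preimage of [B] is the preimage of the cone over [B]. *)
Lemma sphere_vol_orthogonal M (U : sph -> sph) (B : set sph) :
  orthogonal_mx M -> (forall p, sphere_val (U p) = M *m sphere_val p) ->
  measurable B -> vol (U @^-1` B) = vol B.
Proof.
move=> oM UE mB; rewrite /sphere_vol; congr (_ * _)%E.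
rewrite -[RHS](lebesgue_tuple_orthogonal oM); last exact: measurable_cone.
congr (lebesgue_tuple R n.+1 _).
have nM (x : n.+1.-tuple RT) :
    enorm (col_of_tuple (mulmx_tuple M x)) = enorm (col_of_tuple x).
  by rewrite tuple_of_colK enorm_orthmx.
rewrite !coneE; apply/seteqP.
have radM (x : n.+1.-tuple RT) : punctured_ball x ->
    radial (mulmx_tuple M x) = U (radial x).
  rewrite /punctured_ball/= => /andP[x0 _].
  have x0' : enorm (col_of_tuple x) != 0 by rewrite gt_eqF.
  apply: sphere_val_inj; rewrite UE !radial_val ?nM// tuple_of_colK.
  by rewrite -scalemxAr.
split => x /= [Bx xb].
  by split; [rewrite radM|rewrite /punctured_ball/= nM].
have xb' : punctured_ball x by move: xb; rewrite /punctured_ball/= nM.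
by split => //; move: Bx; rewrite radM.
Qed.

Lemma sphere_vol_fin : (vol setT < +oo)%E.
Proof.
apply: (@le_lt_trans _ _ (n.+1%:R%:E * lebesgue_tuple R n.+1 (@tuple_ball R n.+1))%E).
  apply: lee_wpmul2l; first by rewrite lee_fin.
  apply: le_measure; rewrite ?inE; first exact: measurable_cone.
    exact: measurable_tuple_ball.
  rewrite coneE => x [_] /= /andP[_ x1]; rewrite /tuple_ball/= -sqr_enormE.
  by rewrite expr_le1// enorm_ge0.
by rewrite lte_mul_pinfty//; exact: lebesgue_tuple_ball_fin.
Qed.

Lemma enorm_continuous m : continuous (@enorm R m).
Proof.
by move=> x; apply: (@cvg_enorm _ _ _ (nbhs_filter x)) => i; exact: coord_continuous.
Qed.

(** The point p / 2 is interior to the cone over [B], away from the vertex and from the unit sphere;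
    a small cube around it fits into the cone. *)
Lemma sphere_vol_gt0 (B : set sph) p :
  measurable B -> nbhs p B -> (0 < vol B)%E.
Proof.
move=> mB Bp; rewrite /sphere_vol mule_gt0//.
have [W [[V oV VW] Wp WB]] : exists W, [/\ open W, W p & W `<=` B].
  by move: Bp; rewrite nbhsE => -[W [oW Wp] WB]; exists W.
pose x0 : 'cV[R]_n.+1 := 2^-1 *: sphere_val p.
have nx0 : enorm x0 = 2^-1.
  by rewrite enormZ enorm_sphere mulr1 ger0_norm// invr_ge0.
have c1 : \forall x \near x0, 0 < enorm x < 1.
  have : enorm x0 \in `]0, 1[.
    by rewrite in_itv/= nx0 invr_gt0 ltr0n invf_lt1// ltr1n.
  move=> /near_in_itvoo h; near=> x.
  have : enorm x \in `]0, 1[ by near: x; exact: (@enorm_continuous _ x0 _ h).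
  by rewrite in_itv.
have c2 : \forall x \near x0, V ((enorm x)^-1 *: x).
  have : {for x0, continuous (fun x : 'cV[R]_n.+1 => (enorm x)^-1 *: x)}.
    apply: (@cvgZ _ _ _ _ (nbhs_filter x0)); last exact: cvg_id.
    apply: (@cvgV _ _ _ (nbhs_filter x0)); first by rewrite nx0 invr_eq0.
    exact: enorm_continuous.
  apply; rewrite nx0 invrK scalerA mulfV ?scale1r//.
  by apply: open_nbhs_nbhs; split => //; move: Wp; rewrite -VW.
have [e /= e0 eB] := (nbhs_ballP _ _).1 (filterI c1 c2).
pose t0 := tuple_of_col x0.
apply: (@lt_le_trans _ _ (lebesgue_tuple R n.+1 (cube t0 (e / 2)))).
  by rewrite lebesgue_tuple_cube ?lte_fin ?exprn_gt0 ?mulr_gt0// divr_ge0// ltW.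
apply: le_measure; rewrite ?inE; first exact: measurable_cube.
  exact: measurable_cone.
move=> t tC.
have : ball x0 e (col_of_tuple t).
  split => // i j; rewrite (ord1 j) /ball/= distrC.
  have := tC i; rewrite tnth_mktuple => h.
  have : `|(tnth t i : R) - x0 i 0| <= e / 2 by rewrite ler_distl.
  rewrite [col_of_tuple t i 0]mxE => /le_lt_trans; apply.
  by rewrite ltr_pdivrMr// ltr_pMr// ltr1n.
move=> /eB[/= /andP[t1 t2] Vt]; rewrite coneE; split => /=.
  apply: WB; rewrite -VW /= -/(sphere_val _) radial_val//.
  by rewrite gt_eqF.
by rewrite /punctured_ball/= t1 ltW.
Unshelve. all: by end_near. Qed.

End sphere_maps.

(** * Optimality for two eigenvalues *)

Section angle_map.
Context {R : realType}.
Variables (a b : R).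
Hypotheses (a0 : 0 < a) (b0 : 0 < b).
Implicit Types s t : R.

Let weighted_gt0 (x y : R) t :
  0 < x -> 0 < y -> 0 < x * cos t ^+ 2 + y * sin t ^+ 2.
Proof.
move=> x0 y0; have := sqr_ge0 (cos t); rewrite le_eqVlt => /predU1P[c0|c0].
  have s1 : sin t ^+ 2 = 1 by rewrite sin2cos2 -c0 subr0.
  by rewrite -c0 mulr0 add0r s1 mulr1.
apply: (lt_le_trans (mulr_gt0 x0 c0)).
by rewrite lerDl mulr_ge0 ?sqr_ge0// ltW.
Qed.

Let den t := a * cos t ^+ 2 + b * sin t ^+ 2.

Let den_gt0 t : 0 < den t.
Proof. exact: weighted_gt0. Qed.

Definition angle_norm t := Num.sqrt (a ^+ 2 * cos t ^+ 2 + b ^+ 2 * sin t ^+ 2).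

Lemma angle_norm_gt0 t : 0 < angle_norm t.
Proof. by rewrite sqrtr_gt0 weighted_gt0// exprn_gt0. Qed.

(* The arc tangent of (b / a) tan t, written so as to be smooth on R. *)
Definition angle t := t + atan ((b - a) * sin t * cos t / den t).

Let cos_atan_angle t :
  cos (atan ((b - a) * sin t * cos t / den t)) = den t / angle_norm t.
Proof.
rewrite cos_atan.
have -> : 1 + ((b - a) * sin t * cos t / den t) ^+ 2 =
    (angle_norm t / den t) ^+ 2.
  rewrite !expr_div_n sqr_sqrtr; last first.
    by rewrite addr_ge0// mulr_ge0// sqr_ge0.
  have d0 := lt0r_neq0 (den_gt0 t).
  apply: (mulIf (expf_neq0 2 d0)); rewrite mulrDl !divfK ?expf_neq0//.
  rewrite /den; have -> : sin t ^+ 2 = 1 - cos t ^+ 2 by rewrite sin2cos2.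
  rewrite !exprMn; have -> : sin t ^+ 2 = 1 - cos t ^+ 2 by rewrite sin2cos2.
  ring.
by rewrite sqrtr_sqr gtr0_norm ?divr_gt0 ?angle_norm_gt0// invf_div.
Qed.

Let sin_atan_angle t :
  sin (atan ((b - a) * sin t * cos t / den t)) =
  (b - a) * sin t * cos t / angle_norm t.
Proof.
set z := _ / den t.
have c0 : cos (atan z) != 0.
  by rewrite cos_atan_angle mulf_neq0 ?invr_eq0 ?gt_eqF ?angle_norm_gt0.
have : tan (atan z) = z by exact: atanK.
rewrite /tan => /(canRL (divfK c0)) ->; rewrite cos_atan_angle /z.
by field; rewrite !gt_eqF ?angle_norm_gt0.
Qed.

Lemma cos_angle t : cos (angle t) = a * cos t / angle_norm t.
Proof.
rewrite cosD cos_atan_angle sin_atan_angle /den.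
have -> : sin t ^+ 2 = 1 - cos t ^+ 2 by rewrite sin2cos2.
rewrite -[X in _ - X](_ : (1 - cos t ^+ 2) * (b - a) * cos t / angle_norm t = _).
  by field; rewrite gt_eqF ?angle_norm_gt0.
rewrite -sin2cos2 -/den; field; by rewrite gt_eqF ?angle_norm_gt0.
Qed.

Lemma sin_angle t : sin (angle t) = b * sin t / angle_norm t.
Proof.
rewrite sinD cos_atan_angle sin_atan_angle /den.
have r0 : angle_norm t != 0 by rewrite gt_eqF ?angle_norm_gt0.
apply: (mulIf r0); rewrite mulrDl -!mulrA !mulVf// !mulr1.
have -> : cos t * ((b - a) * (sin t * cos t)) = (b - a) * sin t * cos t ^+ 2.
  ring.
have -> : cos t ^+ 2 = 1 - sin t ^+ 2 by rewrite cos2sin2.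
ring.
Qed.

(** The sine of [angle t - angle s] is a positive multiple of sin (t - s). Since [angle] differs
    from the identity by less than pi / 2, a nonpositive difference would lie in [- pi, 0], where
    the sine is not positive. *)
Lemma angle_lt s t : s < t -> t < s + pi -> angle s < angle t.
Proof.
move=> st ts; rewrite -subr_gt0 ltNge; apply/negP => h.
have : 0 < sin (angle t - angle s).
  rewrite sinB !cos_angle !sin_angle.
  have -> : b * sin t / angle_norm t * (a * cos s / angle_norm s) -
      a * cos t / angle_norm t * (b * sin s / angle_norm s) =
      a * b * sin (t - s) / (angle_norm s * angle_norm t).
    rewrite sinB; field; by rewrite !gt_eqF ?angle_norm_gt0.
  rewrite divr_gt0 ?mulr_gt0 ?angle_norm_gt0// sin_gt0_pi//.
  by rewrite subr_gt0 st/= ltrBlDl.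
apply/negP; rewrite -leNgt -oppr_ge0 -sinN sin_ge0_pi// oppr_ge0 h/=.
rewrite /angle lerNl.
set x := _ / den t; set y := _ / den s.
have := atan_gtNpi2 x; have := atan_ltpi2 y; move: st.
by set p : R := pi; set u := atan x; set v := atan y; lra.
Qed.

Lemma angle0 : angle 0 = 0.
Proof. by rewrite /angle sin0 mulr0 !mul0r atan0 addr0. Qed.

Lemma angle_pihalf : angle (pi / 2) = pi / 2.
Proof. by rewrite /angle cos_pihalf mulr0 mul0r atan0 addr0. Qed.

Lemma angle_itv t : 0 <= t <= pi / 2 -> 0 <= angle t <= pi / 2.
Proof.
have p0 := @pi_gt0 R.
move=> /andP[]; rewrite le_eqVlt => /predU1P[<- _|t0].
  by rewrite angle0 lexx divr_ge0// ltW.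
rewrite le_eqVlt => /predU1P[->|t1].
  by rewrite angle_pihalf lexx divr_ge0// ltW.
rewrite -[X in X <= _]angle0 -[X in _ && (_ <= X)]angle_pihalf !ltW//.
  by apply: angle_lt => //; lra.
by apply: angle_lt => //; lra.
Qed.

Lemma angle_continuous : continuous angle.
Proof.
move=> t; apply: cvgD; first exact: cvg_id.
apply: (@continuous_comp _ _ _
  (fun t => (b - a) * sin t * cos t / den t) (@atan R)); last first.
  exact: continuous_atan.
have cc := @continuous_cos R; have cs := @continuous_sin R.
apply: cvgM.
  by apply: cvgM; [apply: cvgM; [exact: cvg_cst|exact: cs]|exact: cc].
apply: cvgV; first by rewrite gt_eqF.
have cX (f : R -> R) : continuous f -> f x ^+ 2 @[x --> t] --> f t ^+ 2.
  by move=> cf; apply: (@continuous_comp _ _ _ f (fun x => x ^+ 2));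
    [exact: cf|exact: exprn_continuous].
by apply: cvgD; apply: cvgM; [exact: cvg_cst|exact: cX|exact: cvg_cst|exact: cX].
Qed.

(** A primitive of the strictly increasing [angle] is strictly convex, so it lies strictly above its
    tangents away from the points of contact. *)
Lemma angle_potential : exists F : R -> R,
  {in `[0, pi / 2]%R, continuous F} /\
  forall s t, 0 <= s <= pi / 2 -> 0 <= t <= pi / 2 -> s != t ->
    angle s * (t - s) < F t - F s.
Proof.
have p0 := @pi_gt0 R.
(* Integrating from -1 makes 0 an interior point, so that [F] is differentiable also at the ends of
   [0, pi / 2]; 5 serves below as an upper end. *)
pose F x := (\int[lebesgue_measure]_(t in `[(-1)%R, x]) angle t)%R.
have itv (t : R) : 0 <= t <= pi / 2 -> -1 < t /\ t < 5 :> R.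
  by have [/andP[_ h] _] := pihalf_02_cos_pihalf R; lra.
have dF t : -1 < t -> t < 5 -> is_derive t 1 F (angle t).
  move=> t1 t5.
  have [|dF F'] := @continuous_FTC1_closed R angle (-1) t 5 t5 _ t1 (@angle_continuous t).
    apply: continuous_compact_integrable; first exact: segment_compact.
    exact/continuous_subspaceT/angle_continuous.
  by apply: DeriveDef; [exact: dF|rewrite -derive1E].
have cF t : 0 <= t <= pi / 2 -> {for t, continuous F}.
  move=> /itv[t1 t5]; apply: differentiable_continuous.
  by apply/derivable1_diffP; have [] := dF t t1 t5.
exists F; split; first by move=> t; rewrite in_itv; exact: cF.
have key s t : 0 <= s -> s < t -> t <= pi / 2 ->
    exists2 c, s < c < t & F t - F s = angle c * (t - s).
  move=> s0 st t1; have [||c cst ->] := @MVT R F angle s t st.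
  - move=> x; rewrite in_itv/= => /andP[sx xt].
    by have [? ?] : -1 < x /\ x < 5; [apply: itv; rewrite (le_trans s0 (ltW sx)) (le_trans (ltW xt))|exact: dF].
  - apply: continuous_in_subspaceT => x; rewrite inE/= in_itv/= => /andP[sx xt].
    by apply: cF; rewrite (le_trans s0 sx) (le_trans xt).
  by exists c => //; rewrite in_itv in cst.
move=> s t /andP[s0 s1] /andP[t0 t1]; rewrite neq_lt => /orP[] st.
  have [c /andP[sc ct] ->] := key _ _ s0 st t1.
  by rewrite ltr_pM2r ?subr_gt0// angle_lt//; lra.
have [c /andP[tc cs] FE] := key _ _ t0 st s1.
rewrite -ltrN2 opprB FE -mulrN opprB ltr_pM2r ?subr_gt0// angle_lt//; lra.
Qed.

End angle_map.

Section two_eigenvalue_image.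
Context {R : realType} {n : nat}.
Notation sph := (sphere R n).
Variables (a b : R) (Q : 'M[R]_n.+1).
Hypotheses (a0 : 0 < a) (b0 : 0 < b) (Qsym : Q^T = Q) (QQ : Q *m Q = Q).
Implicit Types (u v : 'cV[R]_n.+1) (p q : sph).

Let Q' : 'M[R]_n.+1 := 1%:M - Q.
Let P : 'M[R]_n.+1 := a *: Q + b *: Q'.

Let Q'sym : Q'^T = Q'.
Proof. by rewrite linearB /= trmx1 Qsym. Qed.

Let QQ' : Q *m Q' = 0.
Proof. by rewrite mulmxBr mulmx1 QQ subrr. Qed.

Let Q'Q : Q' *m Q = 0.
Proof. by rewrite mulmxBl mul1mx QQ subrr. Qed.

Let Q'Q' : Q' *m Q' = Q'.
Proof. by rewrite {2}/Q' mulmxBr mulmx1 Q'Q subr0. Qed.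

Let dotp_split u v :
  dotp u v = dotp (Q *m u) (Q *m v) + dotp (Q' *m u) (Q' *m v).
Proof.
rewrite dotp_mulmx Qsym mulmxA QQ [X in _ + X]dotp_mulmx Q'sym mulmxA Q'Q'.
by rewrite -dotpDl -mulmxDl addrC subrK mul1mx.
Qed.

Let QP u : Q *m (P *m u) = a *: (Q *m u).
Proof.
by rewrite mulmxA mulmxDr -!scalemxAr QQ QQ' scaler0 addr0 -scalemxAl.
Qed.

Let Q'P u : Q' *m (P *m u) = b *: (Q' *m u).
Proof.
by rewrite mulmxA mulmxDr -!scalemxAr Q'Q' Q'Q scaler0 add0r -scalemxAl.
Qed.

Let sqr_split p :
  enorm (Q *m sphere_val p) ^+ 2 + enorm (Q' *m sphere_val p) ^+ 2 = 1.
Proof. by rewrite !sqr_enormE -dotp_split dotp_sphere. Qed.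

Let enormQ_itv p : 0 <= enorm (Q *m sphere_val p) <= 1.
Proof.
rewrite enorm_ge0/= -(@expr_le1 _ 2)// ?enorm_ge0//.
by rewrite -(sqr_split p) lerDl sqr_ge0.
Qed.

Definition colatitude p := acos (enorm (Q *m sphere_val p)).

Let enormQ_itv' p : -1 <= enorm (Q *m sphere_val p) <= 1.
Proof. by case/andP: (enormQ_itv p) => h -> ; rewrite andbT; lra. Qed.

Lemma cos_colatitude p : cos (colatitude p) = enorm (Q *m sphere_val p).
Proof. by rewrite acosK// in_itv/= enormQ_itv'. Qed.

Lemma sin_colatitude p : sin (colatitude p) = enorm (Q' *m sphere_val p).
Proof.
rewrite sin_acos ?enormQ_itv'// -(sqr_split p) addrAC subrr add0r.
by rewrite sqrtr_sqr ger0_norm ?enorm_ge0.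
Qed.

Lemma colatitude_itv p : 0 <= colatitude p <= pi / 2.
Proof.
rewrite acos_ge0 ?enormQ_itv'//= -acos0; apply: le_acos.
- by rewrite lerN10.
- by case/andP: (enormQ_itv p).
- by case/andP: (enormQ_itv p).
Qed.

Local Notation T := (linear_image P).
Local Notation ang := (angle a b).
Local Notation rad := (angle_norm a b).

Let enormP p : enorm (P *m sphere_val p) = rad (colatitude p).
Proof.
rewrite /angle_norm cos_colatitude sin_colatitude /enorm dotp_split QP Q'P.
congr Num.sqrt; rewrite !sqr_sqrtr ?dotp_ge0// !dotpZl !dotpZr.
by rewrite !mulrA -!expr2.
Qed.

Lemma two_eigenvalue_image_neq0 p : P *m sphere_val p != 0.
Proof. by rewrite -enorm_gt0 enormP angle_norm_gt0. Qed.

Lemma two_eigenvalue_imageE p :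
  sphere_val (T p) = (rad (colatitude p))^-1 *: (P *m sphere_val p).
Proof.
by rewrite linear_imageE ?two_eigenvalue_image_neq0// /projective_image enormP.
Qed.

Let rad_gt0 p : 0 < rad (colatitude p).
Proof. exact: angle_norm_gt0. Qed.

Let enormQT p : enorm (Q *m sphere_val (T p)) = cos (ang (colatitude p)).
Proof.
rewrite two_eigenvalue_imageE -scalemxAr QP cos_angle// cos_colatitude !enormZ.
rewrite !ger0_norm ?invr_ge0 ?(ltW a0) ?(ltW (rad_gt0 p))//.
by rewrite mulrC.
Qed.

Let enormQ'T p : enorm (Q' *m sphere_val (T p)) = sin (ang (colatitude p)).
Proof.
rewrite two_eigenvalue_imageE -scalemxAr Q'P sin_angle// sin_colatitude !enormZ.
rewrite !ger0_norm ?invr_ge0 ?(ltW b0) ?(ltW (rad_gt0 p))//.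
by rewrite mulrC.
Qed.

Let acos_cosB s t : 0 <= s <= pi / 2 -> 0 <= t <= pi / 2 ->
  acos (cos (s - t)) = `|s - t| :> R.
Proof.
move=> /andP[s0 s1] /andP[t0 t1]; rewrite -cos_norm cosK// in_itv/= normr_ge0/=.
have p0 := @pi_gt0 R; rewrite ler_norml; apply/andP; split; lra.
Qed.

(** Cauchy-Schwarz in each eigenspace bounds <p, T q> by cos t cos s + sin t sin s = cos (t - s),
    where t and s are the colatitudes of p and T q. *)
Lemma gdist_image_ge p q :
  `|colatitude p - ang (colatitude q)| <= gdist p (T q).
Proof.
rewrite -acos_cosB ?colatitude_itv ?angle_itv ?colatitude_itv//.
apply: le_acos; first by case/andP: (dotp_sphere_itv p (T q)).
  rewrite cosB cos_colatitude sin_colatitude -enormQT -enormQ'T dotp_split.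
  by apply: lerD; exact: dotp_le_enorm.
exact: cos_le1.
Qed.

Lemma gdist_image p : gdist p (T p) = `|colatitude p - ang (colatitude p)|.
Proof.
rewrite -acos_cosB ?colatitude_itv ?angle_itv ?colatitude_itv//.
congr acos; rewrite cosB cos_colatitude sin_colatitude -enormQT -enormQ'T.
rewrite dotp_split two_eigenvalue_imageE -!scalemxAr QP Q'P !dotpZr !enormZ.
rewrite !ger0_norm ?invr_ge0 ?(ltW a0) ?(ltW b0) ?(ltW (rad_gt0 p))//.
by rewrite -!sqr_enormE; ring.
Qed.

(** Both Cauchy-Schwarz inequalities enter with positive weights [a] and [b], so equality of the
    sums forces equality in each, and then <p, q> = 1. *)
Lemma dotp_image_inj p q : colatitude p = colatitude q ->
  dotp (sphere_val p) (sphere_val (T q)) =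
  dotp (sphere_val q) (sphere_val (T q)) -> p = q.
Proof.
set x := sphere_val p; set y := sphere_val q => pq.
have Qxy : enorm (Q *m x) = enorm (Q *m y) by rewrite -!cos_colatitude pq.
have Q'xy : enorm (Q' *m x) = enorm (Q' *m y) by rewrite -!sin_colatitude pq.
rewrite two_eigenvalue_imageE !dotpZr => /(mulfI (invr_neq0 (lt0r_neq0 (rad_gt0 q)))).
rewrite dotp_split (dotp_split y) !QP !Q'P !dotpZr -!sqr_enormE => h.
have h1 : dotp (Q *m x) (Q *m y) <= enorm (Q *m y) ^+ 2.
  by rewrite (le_trans (dotp_le_enorm _ _))// Qxy -expr2.
have h2 : dotp (Q' *m x) (Q' *m y) <= enorm (Q' *m y) ^+ 2.
  by rewrite (le_trans (dotp_le_enorm _ _))// Q'xy -expr2.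
have xy : dotp x y = 1.
  rewrite dotp_split -(sqr_split q) -/y.
  have {}h1 : 0 <= a * (enorm (Q *m y) ^+ 2 - dotp (Q *m x) (Q *m y)).
    by rewrite mulr_ge0 ?subr_ge0// ltW.
  have {}h2 : 0 <= b * (enorm (Q' *m y) ^+ 2 - dotp (Q' *m x) (Q' *m y)).
    by rewrite mulr_ge0 ?subr_ge0// ltW.
  have e1 : a * (enorm (Q *m y) ^+ 2 - dotp (Q *m x) (Q *m y)) = 0 by lra.
  have e2 : b * (enorm (Q' *m y) ^+ 2 - dotp (Q' *m x) (Q' *m y)) = 0 by lra.
  move: e1 e2 => /eqP + /eqP; rewrite !mulf_eq0 (gt_eqF a0) (gt_eqF b0)/= !subr_eq0.
  by move=> /eqP <- /eqP <-.
apply: sphere_val_inj; apply/eqP; rewrite -subr_eq0 -dotp_eq0 -/x -/y.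
by rewrite dotpBl !dotpBr (dotpC y x) xy !dotp_sphere !subrr.
Qed.

Lemma measurable_colatitude : measurable_fun setT colatitude.
Proof.
apply: measurable_acos_comp; first exact: enormQ_itv'.
apply: (measurableT_comp (f := @Num.sqrt R)).
  apply: continuous_measurable_fun.
  exact: sqrt_continuous.
have mQ i : measurable_fun setT (fun p : sph => (Q *m sphere_val p) i 0).
  under eq_fun do rewrite mxE.
  apply: measurable_sum => j; apply: measurable_funM => //.
  exact: measurable_sphere_coord.
exact: measurable_dotp.
Qed.

(* phi p is t ^ 2 / 2 - F t at the colatitude t of p. *)
Lemma two_eigenvalue_potential : exists phi : sph -> R,
  [/\ measurable_fun setT phi, exists M, forall p, `|phi p| <= M,
      forall p q, cost q (T q) - phi q <= cost p (T q) - phi p &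
      forall p q, cost q (T q) - phi q = cost p (T q) - phi p -> p = q].
Proof.
have [F [cF FP]] := angle_potential a0 b0.
pose psi t := 2^-1 * t ^+ 2 - F t.
have p0 := @pi_gt0 R.
have slope s t : 0 <= s <= pi / 2 -> 0 <= t <= pi / 2 ->
    ang s * (t - s) <= F t - F s.
  move=> hs ht; have [->|st] := eqVneq s t; first by rewrite !subrr mulr0.
  exact/ltW/FP.
have sqr_normr (x : R) : `|x| ^+ 2 = x ^+ 2 by rewrite real_normK ?num_real.
have costE p : cost p (T p) = 2^-1 * (colatitude p - ang (colatitude p)) ^+ 2.
  by rewrite /cost gdist_image sqr_normr.
have cost_geq p q :
    2^-1 * (colatitude p - ang (colatitude q)) ^+ 2 <= cost p (T q).
  rewrite /cost ler_pM2l// -[leLHS]sqr_normr ler_sqr ?nnegrE//.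
    exact: gdist_image_ge.
  by rewrite acos_ge0// dotp_sphere_itv.
exists (psi \o colatitude); split.
- apply: (measurable_comp (F := `[0, pi / 2]%classic)) => //.
  + by move=> _ [p _ <-]; rewrite /= in_itv/= colatitude_itv.
  + apply: measurable_funB.
      by apply: measurable_funM => //; exact: measurable_funX.
    apply: subspace_continuous_measurable_fun => //.
    apply: continuous_in_subspaceT => t; rewrite inE; exact: cF.
  + exact: measurable_colatitude.
(* The slope inequality between 0 and [t], used in both directions, gives F 0 <= F t <= F 0 + angle
   t * t. *)
- exists (pi ^+ 2 + `|F 0| + pi ^+ 2) => p /=.
  have t01 := colatitude_itv p; set t := colatitude p in t01 *.
  have z01 : 0 <= (0 : R) <= pi / 2 by rewrite lexx divr_ge0// ltW.
  have := slope 0 t z01 t01; have := slope t 0 t01 z01.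
  rewrite angle0 mul0r sub0r => h1 h2.
  have := angle_itv a0 b0 t01; move: h1 t01; set w := angle a b t.
  move=> h1 /andP[t0 t1] /andP[w0 w1].
  have tt : t ^+ 2 <= pi ^+ 2 by rewrite ler_sqr ?nnegrE; lra.
  have tw : w * t <= pi ^+ 2 by rewrite expr2; apply: ler_pM => //; lra.
  have := sqr_ge0 t.
  have := ler_norm (F 0); have := ler_norm (- F 0); rewrite normrN.
  by rewrite ler_norml /psi => ? ? ?; apply/andP; split; nra.
(* The squares of the colatitudes cancel and leave the slope inequality of [F]. *)
- move=> p q /=; rewrite costE /psi.
  have := cost_geq p q.
  have := slope _ _ (colatitude_itv q) (colatitude_itv p); lra.
(* Strict convexity forces equal colatitudes; then the distances to [T q] agree as well, and
   [dotp_image_inj] applies. *)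
- move=> p q /=; rewrite costE /psi => h.
  have c1 := cost_geq p q.
  have pq : colatitude q = colatitude p.
    apply/eqP/negPn/negP => pq.
    have := FP _ _ (colatitude_itv q) (colatitude_itv p) pq.
    by move: h c1; lra.
  apply: dotp_image_inj => //.
  have : gdist p (T q) = gdist q (T q).
    apply/eqP; rewrite -(@eqrXn2 _ 2)// ?acos_ge0 ?dotp_sphere_itv//.
    have : cost p (T q) = cost q (T q) by rewrite costE; move: h; rewrite pq; lra.
    by move=> /(mulfI (invr_neq0 (lt0r_neq0 (ltr0n R 2)))) ->.
  move=> /(congr1 (@cos R)); rewrite !acosK ?in_itv//= ?dotp_sphere_itv//.
Qed.

End two_eigenvalue_image.

(** * Integration on the sphere and optimality from a potential *)

Section sphere_integrals.
Context {R : realType} {n : nat}.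
Notation sph := (sphere R n).
Notation vol := (sphere_vol R n).
Implicit Types (f g : sph -> R) (B : set sph).

Definition bounded_measurable f :=
  measurable_fun setT f /\ exists M, forall p, `|f p| <= M.

Lemma bounded_measurableB f g : bounded_measurable f -> bounded_measurable g ->
  bounded_measurable (fun p => f p - g p).
Proof.
move=> [mf [M fM]] [mg [N gN]]; split; first exact: measurable_funB.
by exists (M + N) => p; rewrite (le_trans (ler_normB _ _))// lerD.
Qed.

Lemma bounded_measurableD f g : bounded_measurable f -> bounded_measurable g ->
  bounded_measurable (fun p => f p + g p).
Proof.
move=> [mf [M fM]] [mg [N gN]]; split; first exact: measurable_funD.
by exists (M + N) => p; rewrite (le_trans (ler_normD _ _))// lerD.
Qed.

Lemma bounded_measurable_comp f (V : sph -> sph) : measurable_fun setT V ->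
  bounded_measurable f -> bounded_measurable (f \o V).
Proof.
move=> mV [mf [M fM]]; split; first exact: measurableT_comp.
by exists M => p /=.
Qed.

Lemma bounded_measurable_cost (S T : sph -> sph) :
  measurable_fun setT S -> measurable_fun setT T ->
  bounded_measurable (fun p => cost (S p) (T p)).
Proof.
move=> mS mT; split; first exact: measurable_cost.
by exists (pi ^+ 2) => p; rewrite ger0_norm ?cost_ge0 ?cost_le.
Qed.

Lemma sphere_vol_lty B : measurable B -> (vol B < +oo)%E.
Proof.
move=> mB; apply: le_lt_trans (@sphere_vol_fin R n).
by apply: le_measure; rewrite ?inE.
Qed.

Lemma bounded_measurable_integrable f B : measurable B ->
  bounded_measurable f -> vol.-integrable B (EFin \o f).
Proof.
move=> mB [mf [M fM]]; apply: measurable_bounded_integrable => //.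
- exact: sphere_vol_lty.
- exact: measurable_funTS.
- exists M; split; first exact: num_real.
  by move=> x Mx p _ /=; rewrite (le_trans (fM p))// ltW.
Qed.

Lemma sphere_Rintegral_comp f (V : sph -> sph) B : volume_preserving V ->
  bounded_measurable f -> measurable B ->
  (\int[vol]_(p in V @^-1` B) f (V p) = \int[vol]_(p in B) f p)%R.
Proof.
move=> [mV VE] bf mB; congr fine.
have mVB : measurable (V @^-1` B) by rewrite -[X in measurable X]setTI; exact: mV.
have mf : measurable_fun setT (EFin \o f) by apply/measurable_EFinP; case: bf.
have := integral_pushforward mV mf _ mB.
move=> /(_ vol) <-; last first.
  by apply: (@bounded_measurable_integrable (f \o V)) => //;
     exact: bounded_measurable_comp.
by apply: eq_measure_integral => A mA _; exact: VE.
Qed.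

Lemma sphere_integral_le f g : bounded_measurable f -> bounded_measurable g ->
  (\int[vol]_p (f p)%:E <= \int[vol]_p (g p)%:E)%E =
  (\int[vol]_p f p <= \int[vol]_p g p)%R.
Proof.
move=> bf bg; have If := bounded_measurable_integrable measurableT bf.
have Ig := bounded_measurable_integrable measurableT bg.
by rewrite /Rintegral -lee_fin !fineK//; exact: integrable_fin_num.
Qed.

Lemma sphere_Rintegral_eq0 f B : bounded_measurable f -> measurable B ->
  (forall p, B p -> 0 <= f p) -> (\int[vol]_(p in B) f p = 0)%R ->
  {ae vol, forall p, B p -> f p = 0}.
Proof.
move=> bf mB f0 If0.
have If := bounded_measurable_integrable mB bf.
have mf : measurable_fun B (EFin \o f).
  by apply/measurable_EFinP/measurable_funTS; case: bf.
have : (\int[vol]_(p in B) `|(EFin \o f) p| = 0)%E.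
  under eq_integral => p /set_mem Bp do rewrite gee0_abs ?lee_fin ?f0//.
  have := integrable_fin_num mB If.
  by move=> /fineK <-; rewrite [fine _]If0.
move=> /(ae_eq_integral_abs vol mB mf).
by apply: filterS => p /= h /h [].
Qed.

End sphere_integrals.

Section optimality_criterion.
Context {R : realType} {n : nat}.
Notation sph := (sphere R n).
Notation vol := (sphere_vol R n).

(* Every competitor T' factors as T \o V with V volume preserving; integrate
   the inequality at (p, V p). *)
Lemma potential_optimal_map (T Ti : sph -> sph) (phi : sph -> R)
    (nu : set sph -> \bar R) :
  measurable_fun setT T -> measurable_fun setT Ti ->
  cancel T Ti -> cancel Ti T -> bounded_measurable phi ->
  (forall p q, cost q (T q) - phi q <= cost p (T q) - phi p) ->
  (forall p q, cost q (T q) - phi q = cost p (T q) - phi p -> p = q) ->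
  transports vol nu T ->
  optimal_map vol nu T /\
  forall T', optimal_map vol nu T' -> {ae vol, forall p, T' p = T p}.
Proof.
move=> mT mTi TK TiK bphi phi_le phi_eq tT.
pose h p := cost p (T p) - phi p.
have bT : bounded_measurable (fun p => cost p (T p)).
  exact: bounded_measurable_cost.
have bh : bounded_measurable h by exact: bounded_measurableB.
have key T' : transports vol nu T' ->
    exists D : sph -> R, [/\ bounded_measurable D, forall p, 0 <= D p,
      forall p, D p = 0 -> T' p = T p &
      (\int[vol]_p D p = \int[vol]_p cost p (T' p) - \int[vol]_p cost p (T p))%R].
  move=> [mT' T'E]; pose V := Ti \o T'.
  have mV : measurable_fun setT V by exact: measurableT_comp.
  have VP : volume_preserving V.
    split => // B mB; have mTB : measurable (Ti @^-1` B).
      by rewrite -[X in measurable X]setTI; exact: mTi.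
    rewrite /pushforward comp_preimage -[LHS]/(pushforward vol T' _) T'E//.
    rewrite -tT.2// /pushforward; congr (vol _).
    by apply/seteqP; split => p /=; rewrite TK.
  have bT' : bounded_measurable (fun p => cost p (T' p)).
    exact: bounded_measurable_cost.
  have bc : bounded_measurable (fun p => cost p (T' p) - phi p).
    exact: bounded_measurableB.
  have bhV : bounded_measurable (fun p => h (V p)).
    exact: bounded_measurable_comp.
  have TV p : T (V p) = T' p by rewrite /V /= TiK.
  (* The defect of the potential inequality at (p, V p). As [V] preserves the volume, h (V p) has
     the same integral as [h], and [phi] cancels. *)
  exists (fun p => cost p (T' p) - phi p - h (V p)); split.
  - exact: bounded_measurableB.
  - by move=> p; rewrite subr_ge0 /h -TV phi_le.
  - move=> p /eqP; rewrite subr_eq0 -TV eq_sym => /eqP /phi_eq Vp.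
    by rewrite [in RHS]Vp TV.
  - have hV := sphere_Rintegral_comp VP bh measurableT.
    rewrite preimage_setT in hV.
    rewrite RintegralB// ?hV ?RintegralB//; try exact: bounded_measurable_integrable.
    by rewrite opprB addrA subrK.
split.
  split => // T' tT'; rewrite sphere_integral_le//; last first.
    by apply: bounded_measurable_cost => //; case: tT'.
  have [D [_ D0 _ DE]] := key _ tT'.
  by rewrite -subr_ge0 -DE; apply: Rintegral_ge0.
move=> T' [tT' oT']; have [D [bD D0 DT DE]] := key _ tT'.
have : {ae vol, forall p, setT p -> D p = 0}.
  apply: sphere_Rintegral_eq0 => //; apply/eqP.
  rewrite eq_le Rintegral_ge0// andbT DE subr_le0 -sphere_integral_le//.
    exact: oT'.
  by apply: bounded_measurable_cost => //; case: tT'.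
by apply: filterS => p /= /(_ I) /DT.
Qed.

End optimality_criterion.

Section linear_images.
Context {R : realType} {n : nat}.
Notation sph := (sphere R n).
Notation vol := (sphere_vol R n).

Lemma linear_imageK (M N : 'M[R]_n.+1) : N *m M = 1%:M ->
  cancel (linear_image M : sph -> sph) (linear_image N).
Proof.
move=> NM p; set x := sphere_val p.
have NMx : N *m (M *m x) = x by rewrite mulmxA NM mul1mx.
have Mx0 : M *m x != 0.
  by apply: contraNneq (sphere_val_neq0 p) => Mx0; rewrite -/x -NMx Mx0 mulmx0.
have c0 : 0 < (enorm (M *m x))^-1 by rewrite invr_gt0 enorm_gt0.
have NTx : N *m sphere_val (linear_image M p) = (enorm (M *m x))^-1 *: x.
  by rewrite linear_imageE// /projective_image -scalemxAr NMx.
apply: sphere_val_inj; rewrite linear_imageE; last first.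
  by rewrite NTx scaler_eq0 negb_or gt_eqF//= sphere_val_neq0.
rewrite /projective_image NTx enormZ enorm_sphere mulr1 gtr0_norm//.
by rewrite scalerA mulVf ?scale1r// gt_eqF.
Qed.

Lemma ae_volume_preserving (U : sph -> sph) (E : set sph) :
  volume_preserving U -> {ae vol, forall p, E p} ->
  {ae vol, forall p, E (U p)}.
Proof.
move=> [mU UE] [N [mN N0 EN]]; exists (U @^-1` N); split.
- by rewrite -[X in measurable X]setTI; exact: mU.
- by rewrite -N0; exact: UE.
- by move=> p /= Ep; exact: EN.
Qed.

Lemma volume_preserving_orthogonal (M : 'M[R]_n.+1) (U : sph -> sph) :
  orthogonal_mx M -> (forall p, sphere_val (U p) = M *m sphere_val p) ->
  volume_preserving U.
Proof.
move=> oM UE; split; last by move=> B mB; exact: sphere_vol_orthogonal oM UE mB.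
apply: measurable_to_sphere => i.
under eq_fun do rewrite UE mxE.
apply: measurable_sum => j; apply: measurable_funM => //.
exact: measurable_sphere_coord.
Qed.

Lemma orthogonal_linear_imageE (M : 'M[R]_n.+1) (p : sph) :
  orthogonal_mx M -> sphere_val (linear_image M p) = M *m sphere_val p.
Proof.
move=> oM; have e1 : enorm (M *m sphere_val p) = 1.
  by rewrite enorm_orthmx// enorm_sphere.
by rewrite linear_imageE ?/projective_image ?e1 ?invr1 ?scale1r//
  -enorm_gt0 e1.
Qed.

Lemma two_eigenvalues_coincide (P O : 'M[R]_n.+1) (S : sph -> sph) :
  induced_by (P *m O) S -> self_adjoint P -> positive_definite P ->
  orthogonal_mx O -> at_most_two_eigenvalues P ->
  factorizations_coincide S P O.
Proof.
move=> SE sP pP oO P2.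
have [a [b [Q [a0 b0 Qsym QQ PE]]]] := two_eigenvalues_projection sP pP P2.
have [phi [mphi bphi phi_le phi_eq]] :=
  two_eigenvalue_potential (n := n) a0 b0 Qsym QQ.
rewrite -PE in phi_le phi_eq.
pose T : sph -> sph := linear_image P; pose U : sph -> sph := linear_image O.
have P0 p : P *m sphere_val p != 0.
  by rewrite PE; exact: two_eigenvalue_image_neq0.
have Punit : P \in unitmx.
  rewrite -row_free_unit -kermx_eq0; apply/eqP/row_matrixP => i.
  apply: contrapT => /eqP; rewrite row0 => v0.
  have := pP (row i (kermx P))^T; rewrite -trmx0 (inj_eq trmx_inj) => /(_ v0).
  have -> : P *m (row i (kermx P))^T = 0.
    by apply: trmx_inj; rewrite trmx_mul trmxK sP -row_mul mulmx_ker row0 trmx0.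
  by rewrite dotp0r ltxx.
have TK : cancel T (linear_image (invmx P)) by exact/linear_imageK/mulVmx.
have TiK : cancel (linear_image (invmx P)) T by exact/linear_imageK/mulmxV.
have UE p : sphere_val (U p) = O *m sphere_val p.
  exact: orthogonal_linear_imageE.
have STU p : S p = T (U p).
  apply: sphere_val_inj; rewrite SE linear_imageE// /projective_image.
  by rewrite UE mulmxA.
have VU : volume_preserving U by exact: volume_preserving_orthogonal UE.
have tT : transports vol (pushforward vol S) T.
  split; first exact: measurable_linear_image.
  move=> B mB; have mTB : measurable (T @^-1` B).
    by rewrite -[X in measurable X]setTI; exact: measurable_linear_image.
  rewrite /pushforward -[LHS](VU.2 _ mTB) /pushforward; congr (vol _).
  by apply/seteqP; split => p /=; rewrite STU.
have [oT uT] := potential_optimal_map (measurable_linear_image _)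
  (measurable_linear_image _) TK TiK (conj mphi bphi) phi_le phi_eq tT.
split; first by exists T, U; split => //; exact: aeW.
move=> T' U' [VU' oT' ST'U'].
have TT' := uT _ oT'; split.
  apply: filterS TT' => p ->.
  by rewrite linear_imageE.
(* [U'] pulls null sets back to null sets, so T' = T also holds at [U' p] for almost every [p];
   injectivity of [T] then identifies [U' p] with [U p]. *)
apply: filterS2 ST'U' (ae_volume_preserving VU' TT') => p /=.
by rewrite STU => <- /(can_inj TK) <-.
Qed.

End linear_images.

(** * Failure of cyclic monotonicity for three eigenvalues *)

Section cyclic_monotonicity.
Context {R : realType} {n : nat}.
Notation sph := (sphere R n).
Notation vol := (sphere_vol R n).
Implicit Types (B : set sph) (U T : sph -> sph).

Lemma volume_preserving_comp U1 U2 :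
  volume_preserving U1 -> volume_preserving U2 -> volume_preserving (U1 \o U2).
Proof.
move=> [m1 E1] [m2 E2]; split; first exact: measurableT_comp.
move=> B mB; rewrite /pushforward comp_preimage.
have mU1B : measurable (U1 @^-1` B).
  by rewrite -[X in measurable X]setTI; exact: m1.
by rewrite -[RHS]E1// -[RHS]E2.
Qed.

Lemma volume_preserving_iter U i :
  volume_preserving U -> volume_preserving (iter i U).
Proof.
move=> VU; elim: i => [|i IHi]; first by split => //; exact: measurable_id.
exact: volume_preserving_comp.
Qed.

Lemma volume_preserving_restrict U B :
  volume_preserving U -> measurable B -> U @^-1` B = B ->
  volume_preserving (fun p => if p \in B then U p else p).
Proof.
move=> [mU UE] mB UB; set s := fun p => _.
have sE (C : set sph) : s @^-1` C = (U @^-1` (B `&` C)) `|` (~` B `&` C).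
  rewrite preimage_setI UB; apply/seteqP; rewrite /s; split => p /=.
    by case: ifPn; rewrite ?inE ?notin_setE => Bp; [left|right].
  by case=> -[Bp Cp]; [rewrite mem_set|rewrite memNset].
have mU' (C : set sph) : measurable C -> measurable (U @^-1` C).
  by move=> mC; rewrite -[X in measurable X]setTI; exact: mU.
split.
  move=> _ C mC; rewrite setTI sE; apply: measurableU.
    by apply: mU'; exact: measurableI.
  by apply: measurableI => //; exact: measurableC.
move=> C mC; rewrite /pushforward sE measureU.
- rewrite [X in (X + _)%E](_ : _ = vol (B `&` C)); last first.
    by apply: UE; exact: measurableI.
  rewrite -measureU -?setIUl ?setUv ?setTI//.
  + exact: measurableI.
  + by apply: measurableI => //; exact: measurableC.
  + by rewrite setIACA setICr set0I.
- by apply: mU'; exact: measurableI.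
- by apply: measurableI => //; exact: measurableC.
- by rewrite preimage_setI UB setIACA setICr set0I.
Qed.

(** Precomposing the optimal [T'] with [U] does not change the image measure, hence gives a
    competitor. The comparison passes to the everywhere explicit [T] because both compositions agree
    almost everywhere. *)
Lemma optimal_map_precomp (nu : set sph -> \bar R) T T' U :
  optimal_map vol nu T' -> measurable_fun setT T ->
  {ae vol, forall p, T' p = T p} -> volume_preserving U ->
  (\int[vol]_p cost p (T p) <= \int[vol]_p cost p (T (U p)))%R.
Proof.
move=> [[mT' T'E] oT'] mT TT' VU; have [mU UE] := VU.
have tT'U : transports vol nu (T' \o U).
  split; first exact: measurableT_comp.
  move=> B mB; rewrite -T'E// /pushforward comp_preimage; apply: UE.
  by rewrite -[X in measurable X]setTI; exact: mT'.
have mTU : measurable_fun setT (T \o U) by exact: measurableT_comp.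
have mT'U : measurable_fun setT (T' \o U) by exact: measurableT_comp.
have mc (X : sph -> sph) : measurable_fun setT X ->
    measurable_fun setT (fun p => (cost p (X p))%:E).
  by move=> mX; apply/measurable_EFinP; exact: measurable_cost.
rewrite -sphere_integral_le; [|exact: bounded_measurable_cost..].
have -> : (\int[vol]_p (cost p (T p))%:E = \int[vol]_p (cost p (T' p))%:E)%E.
  apply: ae_eq_integral => //; [exact: mc|exact: mc|].
  by apply: filterS TT' => p -> _.
have -> : (\int[vol]_p (cost p (T (U p)))%:E =
    \int[vol]_p (cost p ((T' \o U) p))%:E)%E.
  apply: ae_eq_integral => //; [exact: (mc (T \o U))|exact: mc|].
  by apply: filterS (ae_volume_preserving VU TT') => p /= -> _.
exact: oT'.
Qed.

(** When [U] has period [N]: the cost saved on the orbit of [p] by sending every point to the image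
    of its successor, that is, the violation of cyclic monotonicity along this orbit. *)
Definition cycle_gain T U N p : R :=
  \sum_(i < N) (cost (iter i U p) (T (iter i U p)) -
                cost (iter i U p) (T (iter i.+1 U p))).

Lemma cycle_gain_invariant T U N p :
  iter N U p = p -> cycle_gain T U N (U p) = cycle_gain T U N p.
Proof.
pose f i := cost (iter i U p) (T (iter i U p)) -
            cost (iter i U p) (T (iter i.+1 U p)).
move=> UN; transitivity (\sum_(i < N) f i.+1).
  by apply: eq_bigr => i _; rewrite -!iterSr.
case: N UN => [|N] UN; first by rewrite /cycle_gain !big_ord0.
rewrite /cycle_gain big_ord_recr [RHS]big_ord_recl addrC; congr (_ + _).
by rewrite /f /=; move: UN => /= ->.
Qed.

(* B = {cycle_gain > 0} is U-invariant; moving by U on B and fixing the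
   complement is volume preserving, and the cost it saves is the N-th part of
   the integral of cycle_gain over B. *)
Lemma optimal_cycle_gain (nu : set sph -> \bar R) T T' U N :
  optimal_map vol nu T' -> measurable_fun setT T ->
  {ae vol, forall p, T' p = T p} -> volume_preserving U ->
  (0 < N)%N -> (forall p, iter N U p = p) ->
  measurable [set p | 0 < cycle_gain T U N p] /\
  vol [set p | 0 < cycle_gain T U N p] = 0%E.
Proof.
move=> oT' mT TT' VU N0 UN; set G := cycle_gain T U N.
have mU := VU.1.
pose d p := cost p (T p) - cost p (T (U p)).
have bTU : bounded_measurable (fun p => cost p (T (U p))).
  by apply: bounded_measurable_cost => //; exact: (measurableT_comp mT mU).
have bT : bounded_measurable (fun p => cost p (T p)).
  exact: bounded_measurable_cost.
have bd : bounded_measurable d by exact: bounded_measurableB.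
have bdi i : bounded_measurable (fun p => d (iter i U p)).
  exact: (bounded_measurable_comp (volume_preserving_iter i VU).1 bd).
have GE p : G p = \sum_(i < N) d (iter i U p) by [].
have mG : measurable_fun setT G.
  by apply: measurable_sum => i; case: (bdi i).
have bG : bounded_measurable G.
  split => //; have [_ [M dM]] := bd; exists (\sum_(i < N) M) => p.
  by rewrite GE (le_trans (ler_norm_sum _ _ _))// ler_sum.
set B := [set p | 0 < G p].
have mB : measurable B.
  have -> : B = G @^-1` `]0, +oo[.
    by apply/seteqP; split => p /=; rewrite in_itv/= andbT.
  by rewrite -[X in measurable X]setTI; exact: mG.
split => //.
have UB : U @^-1` B = B.
  by apply/seteqP; split => p /=; rewrite /B/= /G cycle_gain_invariant.
have UiB i : iter i U @^-1` B = B.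
  elim: i => [|i IHi]; first exact: preimage_id.
  by rewrite (_ : iter i.+1 U = U \o iter i U)// comp_preimage UB.
have d_le0 : \int[vol]_(p in B) d p <= 0.
  have := optimal_map_precomp oT' mT TT' (volume_preserving_restrict VU mB UB).
  have bs : bounded_measurable (fun p => cost p (T (if p \in B then U p else p))).
    apply: bounded_measurable_cost => //; apply: (measurableT_comp mT).
    exact: (volume_preserving_restrict VU mB UB).1.
  rewrite -subr_le0 -RintegralB//; try exact: bounded_measurable_integrable.
  apply: le_trans; rewrite Rintegral_mkcond le_eqVlt; apply/orP; left; apply/eqP.
  apply: eq_Rintegral => p _; rewrite patchE; case: ifPn => // _.
  by rewrite subrr.
have dU i : \int[vol]_(p in B) d (iter i U p) = \int[vol]_(p in B) d p.
  by rewrite -{1}(UiB i); exact: sphere_Rintegral_comp (volume_preserving_iter i VU) bd mB.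
have IG k : \int[vol]_(p in B) (\sum_(i < k) d (iter i U p)) =
    k%:R * \int[vol]_(p in B) d p /\
    bounded_measurable (fun p => \sum_(i < k) d (iter i U p)).
  elim: k => [|k [IH bk]].
    split; last first.
      under eq_fun do rewrite big_ord0.
      by split => //; exists 0 => p; rewrite normr0.
    under eq_Rintegral do rewrite big_ord0.
    by rewrite Rintegral_cst// !mul0r.
  split; last first.
    under eq_fun do rewrite big_ord_recr/=.
    exact: bounded_measurableD.
  under eq_Rintegral do rewrite big_ord_recr/=.
  rewrite RintegralD//; try exact: bounded_measurable_integrable.
  by rewrite IH dU mulrSr mulrDl mul1r.
(* By [IG] this integral is [N] times a nonpositive number, whereas [G > 0] on [B]; hence [B] is
   null. *)
have G0 : \int[vol]_(p in B) G p = 0.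
  apply/eqP; rewrite eq_le Rintegral_ge0 ?andbT; last by move=> p /ltW.
  by rewrite [leLHS](IG N).1 pmulr_rle0// ltr0n.
have [C [mC C0 BC]] := sphere_Rintegral_eq0 bG mB (fun p Bp => ltW Bp) G0.
apply: (subset_measure0 mB mC _ C0) => p Bp; apply: BC => /= /(_ Bp) Gp0.
by move: Bp; rewrite /B/= Gp0 ltxx.
Qed.

End cyclic_monotonicity.

(** * Estimates for sine, cosine and arc cosine *)

Section trigonometric_bounds.
Context {R : realType}.
Implicit Types x y s t h : R.

Lemma sin_mvt x y : x < y -> exists2 c, x < c < y & sin y - sin x = cos c * (y - x).
Proof.
move=> xy; have [|c cxy E] := @MVT R (@sin R) (@cos R) x y xy.
  by apply: continuous_subspaceT; exact: continuous_sin.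
by exists c => //; rewrite in_itv in cxy.
Qed.

Lemma cos_mvt x y : x < y -> exists2 c, x < c < y & cos y - cos x = - sin c * (y - x).
Proof.
move=> xy; have [|c cxy E] := @MVT R (@cos R) (fun z => - sin z) x y xy.
  by apply: continuous_subspaceT; exact: continuous_cos.
by exists c => //; rewrite in_itv in cxy.
Qed.

Lemma lt_mulcos_sin x : 0 < x < pi / 2 -> x * cos x < sin x < x.
Proof.
move=> /andP[x0 x1]; have [c /andP[c0 cx]] := sin_mvt x0.
rewrite sin0 !subr0 => ->; have p0 := @pi_gt0 R.
have cc : cos c < 1 by rewrite -cos0 ltr_cos// in_itv/=; lra.
have xc : cos x < cos c by rewrite ltr_cos// in_itv/=; lra.
by rewrite gtr_pMl// cc andbT mulrC ltr_pM2r.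
Qed.

Lemma sin_lipschitz x y : `|sin y - sin x| <= `|y - x|.
Proof.
wlog xy : x y / x < y => [H|].
  have [/H //|/H|->] := ltgtP x y; last by rewrite !subrr.
  by rewrite distrC (distrC x).
have [c _ ->] := sin_mvt xy.
by rewrite normrM ler_piMl// cos_max.
Qed.

Lemma onem_cos_le h : 0 < h -> 0 <= 1 - cos h <= h ^+ 2.
Proof.
move=> h0; have [c /andP[c0 ch]] := cos_mvt h0.
rewrite cos0 subr0 => E; rewrite subr_ge0 cos_le1/=.
have -> : 1 - cos h = sin c * h by lra.
rewrite expr2 ler_pM2r//; have := sin_lipschitz 0 c.
rewrite sin0 !subr0 => /(le_trans (ler_norm _)) /le_trans; apply.
by rewrite ger0_norm// ltW.
Qed.

(** This is the decrease of t cot t. With d = t - s, the identity [E] reduces it to d cos t sin s <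
    s sin d, which follows from sin s < s, cos t < cos d and d cos d < sin d. *)
Lemma decreasing_mulcotan s t : 0 < s -> s < t -> t < pi / 2 ->
  t * cos t * sin s < s * cos s * sin t.
Proof.
move=> s0 st t1; have p0 := @pi_gt0 R.
have /andP[d1 d2] : (t - s) * cos (t - s) < sin (t - s) < t - s.
  by apply: lt_mulcos_sin; apply/andP; split; lra.
have /andP[s1 s2] : s * cos s < sin s < s.
  by apply: lt_mulcos_sin; apply/andP; split; lra.
have ct : 0 < cos t by apply: cos_gt0_pihalf; apply/andP; split; lra.
have cd : cos t < cos (t - s) by rewrite ltr_cos// ?in_itv/=; lra.
have E : s * sin (t - s) - (t - s) * cos t * sin s =
    s * cos s * sin t - t * cos t * sin s by rewrite sinB; ring.
rewrite -subr_gt0 -E subr_gt0.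
apply: (@lt_trans _ _ ((t - s) * cos t * s)).
  by rewrite ltr_pM2l// mulr_gt0// subr_gt0.
rewrite [ltRHS]mulrC ltr_pM2r//; apply: lt_trans d1.
by rewrite ltr_pM2l// subr_gt0.
Qed.

Lemma acos_div_sin_le x (hi : R) : 0 <= x <= hi -> hi < 1 ->
  0 <= acos x / sin (acos x) <= 2 / sin (acos hi).
Proof.
move=> /andP[x0 x1] hi1; have p0 := @pi_gt0 R.
have hi0 : 0 <= hi by exact: le_trans x1.
have xi : -1 <= x <= 1 by apply/andP; split; lra.
have hii : -1 <= hi <= 1 by apply/andP; split; lra.
have s0 : 0 < sin (acos hi).
  by rewrite sin_gt0_pi// acos_gt0 ?acos_ltpi//; apply/andP; split; lra.
have sx : sin (acos hi) <= sin (acos x).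
  by rewrite !sin_acos// ler_wsqrtr// lerD2l lerN2 ler_sqr ?nnegrE.
have a0 := acos_ge0 xi.
apply/andP; split; first by rewrite divr_ge0// (le_trans (ltW s0)).
apply: ler_pM => //.
- by rewrite invr_ge0 (le_trans (ltW s0)).
- have [/andP[_ h2] _] := pihalf_02_cos_pihalf R; apply: le_trans h2.
  by rewrite -acos0 le_acos//; lra.
- by rewrite lef_pV2 ?posrE// (lt_le_trans s0).
Qed.

(* Second-order expansion of acos ^ 2 / 2 away from the endpoints. *)
Lemma sqr_acos_lower x y (hi : R) : 0 <= x <= hi -> 0 <= y <= hi -> hi < 1 ->
  acos x / sin (acos x) * (y - x) -
    (2 / sin (acos hi) + 1) * (`|y - x| / sin (acos hi)) ^+ 2 <=
  2^-1 * acos x ^+ 2 - 2^-1 * acos y ^+ 2.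
Proof.
have p0 := @pi_gt0 R.
move=> xB /andP[y0 y1] hi1; have aq := acos_div_sin_le xB hi1.
have /andP[x0 x1] := xB.
have hi0 : 0 <= hi by exact: le_trans x1.
have tm0 : 0 < acos hi by apply: acos_gt0; apply/andP; split; lra.
have rng z : 0 <= z <= hi -> acos hi <= acos z <= pi / 2.
  by move=> /andP[z0 z1]; rewrite -acos0 !le_acos//; lra.
have /andP[tx1 tx2] : acos hi <= acos x <= pi / 2 by apply: rng; rewrite x0.
have /andP[ty1 ty2] : acos hi <= acos y <= pi / 2 by apply: rng; rewrite y0.
have cx : cos (acos x) = x by rewrite acosK// in_itv/=; lra.
have cy : cos (acos y) = y by rewrite acosK// in_itv/=; lra.
have sinm z : acos hi <= z <= pi / 2 -> sin (acos hi) <= sin z.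
  move=> /andP[z0 z1]; rewrite leNgt; apply/negP.
  rewrite ltr_sin ?in_itv/=; lra.
have sm0 : 0 < sin (acos hi) by apply: sin_gt0_pi; apply/andP; split; lra.
have sx : sin (acos hi) <= sin (acos x) by apply: sinm; rewrite tx1.
move: cx cy sx tx1 tx2 ty1 ty2 sinm sm0 tm0 aq {p0 xB}.
set a := acos x; set b := acos y; set m := acos hi; set sm := sin m.
move=> cx cy sx a1 a2 b1 b2 sinm sm0 m0 aq.
have [c [c1 c2 c3 E]] : exists c, [/\ m <= c <= pi / 2, `|sin c - sin a| <= `|a - b|,
    sm <= sin c & y - x = (a - b) * sin c].
  rewrite -cx -cy; have [ab|ab|ab] := ltgtP a b.
  - have [c /andP[c1 c2] E] := cos_mvt ab; exists c; split.
    + by apply/andP; split; lra.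
    + rewrite (le_trans (sin_lipschitz _ _))// distrC.
      rewrite !ler0_norm; lra.
    + by apply: sinm; apply/andP; split; lra.
    + by rewrite E; ring.
  - have [c /andP[c1 c2] E] := cos_mvt ab; exists c; split.
    + by apply/andP; split; lra.
    + rewrite (le_trans (sin_lipschitz _ _))// distrC.
      rewrite !ger0_norm; lra.
    + by apply: sinm; apply/andP; split; lra.
    + by rewrite -opprB E; ring.
  - exists a; rewrite ab !subrr normr0 mul0r; split => //.
      by rewrite -ab a1 a2.
    by rewrite -ab.
have sa0 : 0 < sin a by exact: lt_le_trans sx.
have sc0 : 0 < sin c by exact: lt_le_trans c3.
have tau : `|a - b| <= `|y - x| / sm.
  rewrite ler_pdivlMr// E normrM (gtr0_norm sc0).
  by rewrite ler_wpM2l.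
set q := a / sin a in aq *.
have qa : q * sin a = a by rewrite /q divfK// gt_eqF.
set T := `|y - x| / sm in tau *.
have T2 : (a - b) ^+ 2 <= T ^+ 2.
  by rewrite -[leLHS]real_normK ?num_real// ler_sqr ?nnegrE ?(le_trans _ tau).
have d2 : (a - b) * (sin c - sin a) <= (a - b) ^+ 2.
  rewrite (le_trans (ler_norm _))// normrM -[leRHS]real_normK ?num_real//.
  by rewrite expr2 ler_wpM2l.
(* Here a = q sin a, while the mean value theorem gives y - x = (a - b) sin c; exchanging sin a for
   sin c costs at most q (a - b) ^ 2. *)
have -> : 2^-1 * a ^+ 2 - 2^-1 * b ^+ 2 =
    q * sin a * (a - b) - 2^-1 * (a - b) ^+ 2 by rewrite qa; field.
rewrite E; have /andP[q0 q2] := aq.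
have h1 : q * ((a - b) * (sin c - sin a)) <= q * (a - b) ^+ 2.
  by rewrite ler_wpM2l.
have h2 : q * (a - b) ^+ 2 <= 2 / sm * T ^+ 2.
  by apply: ler_pM => //; exact: sqr_ge0.
have T0 : 0 <= T ^+ 2 by exact: sqr_ge0.
lra.
Qed.

End trigonometric_bounds.

(** * Circulation of the displacement along a great circle *)

Section circulation.
Context {R : realType}.
Variables (al be A B C : R).
Hypotheses (be0 : 0 < be) (beal : be < al) (C0 : 0 < C).
Implicit Types (t h : R).

(** For p_t = cos t u + sin t v, these three functions are <p_s, P p_t>, |P p_t| ^ 2 and the cosine
    of the distance from p_s to T p_t. *)
Definition circle_form s t : R := al * cos s * cos t + be * sin s * sin t.
Definition circle_sqnorm t : R :=
  A * cos t ^+ 2 + B * sin t ^+ 2 + 2 * C * (sin t * cos t).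
Definition circle_cos s t : R := circle_form s t / Num.sqrt (circle_sqnorm t).

Local Notation m t := (circle_form t t).
Local Notation k := circle_sqnorm.
Local Notation x0 t := (circle_cos t t).

(** Strict Cauchy-Schwarz: [T] moves every point of the circle, which keeps [x0] below 1, where
    [acos] is not differentiable. *)
Hypothesis mk : forall t, m t ^+ 2 < k t.

Let m_ge t : be <= m t.
Proof.
have -> : m t = be + (al - be) * cos t ^+ 2.
  have -> : be = be * (cos t ^+ 2 + sin t ^+ 2) by rewrite cos2Dsin2 mulr1.
  rewrite /circle_form; have := cos2Dsin2 t; set c := cos t; set s := sin t.
  move=> cs; have -> : (al - be * (c ^+ 2 + s ^+ 2)) = al - be by rewrite cs mulr1.
  ring.
by rewrite lerDl mulr_ge0 ?sqr_ge0// subr_ge0 ltW.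
Qed.

Let m_gt0 t : 0 < m t. Proof. exact: lt_le_trans (m_ge t). Qed.

Let k_gt0 t : 0 < k t.
Proof. by apply: le_lt_trans (mk t); rewrite sqr_ge0. Qed.

Let sk_gt0 t : 0 < Num.sqrt (k t). Proof. by rewrite sqrtr_gt0. Qed.

Let mN t : m (- t) = m t.
Proof. by rewrite /circle_form cosN sinN; ring. Qed.

Let m_lt_sk t : m t < Num.sqrt (k t).
Proof.
rewrite -[X in X < _]gtr0_norm// -sqrtr_sqr ltr_sqrt//.
Qed.

Let x0_gt0 t : 0 < x0 t. Proof. exact: divr_gt0. Qed.

Let x0_lt1 t : x0 t < 1. Proof. by rewrite ltr_pdivrMr// mul1r. Qed.

(** The derivative of [circle_cos s t] in [s] at [s = t]. *)
Let y t := (be - al) * (sin t * cos t) / Num.sqrt (k t).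

Let y_le t : `|y t| <= (al - be) / be.
Proof.
have -> : `|y t| = (al - be) * `|sin t * cos t| / Num.sqrt (k t).
  have ab : `|be - al| = al - be by rewrite distrC gtr0_norm// subr_gt0.
  by rewrite /y !normrM normfV (gtr0_norm (sk_gt0 t)) ab.
have sk : be <= Num.sqrt (k t) by rewrite (le_trans (m_ge t))// ltW.
apply: ler_pM.
- by rewrite mulr_ge0// subr_ge0 ltW.
- by rewrite invr_ge0 ltW.
- by rewrite ler_piMr ?subr_ge0 ?(ltW beal)// normrM mulr_ile1 ?sin_max ?cos_max.
- by rewrite lef_pV2 ?posrE.
Qed.

Let step t h : circle_cos (t + h) t - x0 t = y t * sin h - (1 - cos h) * x0 t.
Proof.
rewrite /circle_cos /y /circle_form cosD sinD; field.
by rewrite gt_eqF.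
Qed.

(** The form <log_p T p, dp> on the unit tangent of the circle: minus the derivative of the cost in
    its first argument. *)
Let D t := acos (x0 t) / sin (acos (x0 t)) * y t.

Let continuous_x0 : continuous (fun t => x0 t).
Proof.
move=> t; have cc := @continuous_cos R t; have cs := @continuous_sin R t.
have cX (f : R -> R) : {for t, continuous f} -> f x ^+ 2 @[x --> t] --> f t ^+ 2.
  by move=> cf; apply: (@continuous_comp _ _ _ f (fun x => x ^+ 2));
    [exact: cf|exact: exprn_continuous].
apply: cvgM.
  by apply: cvgD; apply: cvgM => //; apply: cvgM => //; exact: cvg_cst.
apply: cvgV; first by rewrite gt_eqF.
apply: (@continuous_comp _ _ _ k Num.sqrt); last exact: sqrt_continuous.
apply: cvgD.
  by apply: cvgD; apply: cvgM; try exact: cvg_cst; exact: cX.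
by apply: cvgM; [exact: cvg_cst|exact: cvgM].
Qed.

(** Compactness makes the bounds uniform; the interval contains all the angles i h and - i h summed
    in [circle_gain]. *)
Let x0_bounds : exists lo hi, [/\ 0 < lo, hi < 1 &
  forall t, - (2 * pi) <= t <= 2 * pi -> lo <= x0 t <= hi].
Proof.
have p0 := @pi_gt0 R.
have ab : - (2 * pi) <= 2 * pi :> R by lra.
have cw := continuous_subspaceT (A := `[- (2 * pi), 2 * pi]%classic) continuous_x0.
have [c1 _ h1] := EVT_max ab cw; have [c2 _ h2] := EVT_min ab cw.
exists (x0 c2), (x0 c1); split; rewrite ?x0_gt0 ?x0_lt1// => t ht.
by rewrite h1 ?h2// in_itv.
Qed.

Let gain_lower : exists K h0, [/\ 0 < h0, 0 <= K & forall t h,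
  - (2 * pi) <= t <= 2 * pi -> 0 < h < h0 ->
  sin h * D t - K * h ^+ 2 <=
  2^-1 * acos (x0 t) ^+ 2 - 2^-1 * acos (circle_cos (t + h) t) ^+ 2].
Proof.
have [lo [hi [lo0 hi1 x0B]]] := x0_bounds.
pose Y := (al - be) / be; pose hi' := (1 + hi) / 2; pose sm := sin (acos hi').
have Y0 : 0 <= Y by rewrite divr_ge0 ?subr_ge0 ?(ltW beal) ?(ltW be0).
have p0 := @pi_gt0 R.
have hi0 : 0 < hi.
  have z : - (2 * pi) <= (0 : R) <= 2 * pi by apply/andP; split; lra.
  by have /andP[h1 h2] := x0B 0 z; exact: lt_le_trans (le_trans h1 h2).
have hi'01 : hi < hi' < 1 by rewrite /hi'; apply/andP; split; lra.
have /andP[hi'0 hi'1] := hi'01.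
have sm0 : 0 < sm.
  apply: sin_gt0_pi; rewrite acos_gt0 ?acos_ltpi//; apply/andP; split; lra.
(* The first summand pays for the term 1 - cos h of [step], the second for the quadratic remainder,
   as a step moves the cosine by at most h (Y + 1). The bound on h keeps the moved cosine between 0
   and [hi'], midway between [hi] and 1. *)
exists (2 / sm + (2 / sm + 1) * ((Y + 1) / sm) ^+ 2),
  (Num.min 1 (Num.min (lo / (Y + 1)) ((hi' - hi) / (Y + 1)))).
have Y1 : 0 < Y + 1 by lra.
split.
- by rewrite !lt_min ltr01 !divr_gt0// subr_gt0.
- have sm2 : 0 <= 2 / sm by rewrite divr_ge0// ltW.
  by rewrite addr_ge0// mulr_ge0 ?sqr_ge0// addr_ge0.
move=> t h tB /andP[h0]; rewrite !lt_min !ltr_pdivlMr// => /and3P[h1 hlo hhi].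
have /andP[x0lo x0hi] := x0B t tB; have x01 := x0_lt1 t.
have /andP[c0 c1] := onem_cos_le h0.
have sh : `|sin h| <= h.
  by have := sin_lipschitz 0 h; rewrite sin0 !subr0 (gtr0_norm h0).
have hh : h ^+ 2 <= h by rewrite expr2 ler_piMl// ltW.
have dx : `|circle_cos (t + h) t - x0 t| <= h * (Y + 1).
  rewrite step (le_trans (ler_normB _ _))// mulrDr mulr1 lerD//.
    by rewrite normrM mulrC ler_pM// y_le.
  rewrite normrM (ger0_norm c0) (gtr0_norm (x0_gt0 t)).
  by rewrite (le_trans _ hh)// (le_trans _ c1)// ler_piMr// ltW.
move: (dx); rewrite ler_norml => /andP[dx1 dx2].
have low := @sqr_acos_lower R (x0 t) (circle_cos (t + h) t) hi' _ _ hi'1.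
apply: le_trans (low _ _); last 2 first.
  by apply/andP; split; lra.
  by apply/andP; split; lra.
have hB : 0 <= x0 t <= hi' by apply/andP; split; lra.
rewrite step /D; have /andP[] := acos_div_sin_le hB hi'1; rewrite -/sm.
set q := acos (x0 t) / _ => q0 q2.
have e1 : q * ((1 - cos h) * x0 t) <= 2 / sm * h ^+ 2.
  apply: ler_pM => //; first by rewrite mulr_ge0// ltW.
  by rewrite (le_trans _ c1)// ler_piMr// ltW.
have e2 : (2 / sm + 1) * (`|y t * sin h - (1 - cos h) * x0 t| / sm) ^+ 2 <=
    (2 / sm + 1) * ((Y + 1) / sm) ^+ 2 * h ^+ 2.
  rewrite -mulrA ler_wpM2l//; first by rewrite addr_ge0// divr_ge0// ltW.
  rewrite -exprMn ler_sqr ?nnegrE ?divr_ge0 ?mulr_ge0 ?invr_ge0 ?(ltW sm0) ?(ltW h0) ?(ltW Y1)//.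
  have -> : (Y + 1) / sm * h = h * (Y + 1) / sm by ring.
  by rewrite ler_pM2r ?invr_gt0// -step.
lra.
Qed.

Let H t := acos (x0 t) / (sin (acos (x0 t)) * Num.sqrt (k t)).

(** With r = acos (x0 t), [H t] equals r cot r / m t. For fixed [m], a larger [k] means a larger r,
    and r cot r is decreasing. *)
Let H_lt s t : m s = m t -> k s < k t -> H t < H s.
Proof.
move=> mst kst.
have sk : Num.sqrt (k s) < Num.sqrt (k t) by rewrite ltr_sqrt.
have p0 := @pi_gt0 R.
have ac r : 0 < acos (x0 r) < pi / 2.
  have xi : 0 < x0 r < 1 by rewrite x0_gt0 x0_lt1.
  case/andP: xi => xi0 xi1; rewrite acos_gt0 -?acos0 ?lt_acos//; last 2 first.
    exact: ltW.
    by apply/andP; split; lra.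
have xts : x0 t < x0 s.
  by rewrite /circle_cos mst ltr_pM2l// ltf_pV2 ?posrE.
have ast : acos (x0 s) < acos (x0 t).
  by apply: lt_acos => //; [have := x0_gt0 t; lra|exact/ltW].
have sin0 r : 0 < sin (acos (x0 r)).
  by case/andP: (ac r) => ? ?; apply: sin_gt0_pi; apply/andP; split; lra.
have skE r : Num.sqrt (k r) = m r / cos (acos (x0 r)).
  have xr := x0_gt0 r; have x1 := x0_lt1 r.
  rewrite acosK ?in_itv/=; last by apply/andP; split; lra.
  by rewrite /circle_cos invf_div mulrCA mulfV ?mulr1 ?gt_eqF.
have cos0 r : 0 < cos (acos (x0 r)).
  have xr := x0_gt0 r; have x1 := x0_lt1 r.
  by rewrite acosK ?in_itv//=; apply/andP; split; lra.
have /andP[as0 as1] := ac s; have /andP[at0 at1] := ac t.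
have := decreasing_mulcotan as0 ast at1.
have HE r : H r = acos (x0 r) * cos (acos (x0 r)) / sin (acos (x0 r)) / m r.
  rewrite /H skE; field.
  by rewrite !gt_eqF.
rewrite !HE mst ltr_pM2r ?invr_gt0// => dm.
by rewrite ltr_pdivrMr// mulrAC ltr_pdivlMr.
Qed.

Let W t := D t + D (- t).

Let WE t : W t = (al - be) * ((sin t * cos t) * (H (- t) - H t)).
Proof.
rewrite /W /D /y /H sinN cosN; set X := sin _; set Z := sin (acos (x0 (- t))).
have XZ : forall r, 0 < sin (acos (x0 r)).
  move=> r; have xr := x0_gt0 r; have x1 := x0_lt1 r.
  by rewrite sin_gt0_pi// acos_gt0 ?acos_ltpi//; apply/andP; split; lra.
by field; rewrite !gt_eqF//; exact: XZ.
Qed.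

(** [m] takes the same value at t and - t, while [k] differs by 4 C sin t cos t. *)
Let W_gt0 t : 0 < sin t * cos t -> 0 < W t.
Proof.
move=> sc; rewrite WE; apply: mulr_gt0; first by rewrite subr_gt0.
apply: mulr_gt0 => //; rewrite subr_gt0; apply: H_lt; rewrite ?mN//.
rewrite -subr_gt0.
have -> : k t - k (- t) = 2 * (2 * (C * (sin t * cos t))).
  by rewrite /circle_sqnorm sinN cosN; ring.
by do 3!apply: mulr_gt0 => //.
Qed.

Let WN t : W (- t) = W t.
Proof. by rewrite /W opprK addrC. Qed.

Let W_ge0 t : 0 <= W t.
Proof.
have [sc|sc|sc] := ltgtP (sin t * cos t) 0.
- by rewrite -WN ltW// W_gt0// sinN cosN mulNr oppr_gt0.
- exact/ltW/W_gt0.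
- by rewrite WE sc mul0r mulr0.
Qed.

Let W_lower : exists2 eta, 0 < eta &
  forall t, pi / 6 <= t <= pi / 3 -> eta <= W t.
Proof.
have p0 := @pi_gt0 R.
have ab : pi / 6 <= pi / 3 :> R by lra.
have cD : continuous D.
  move=> t; have xr := x0_gt0 t; have x1 := x0_lt1 t.
  have ca : acos (x0 s) @[s --> t] --> acos (x0 t).
    apply: (@continuous_comp _ _ _ (fun t => x0 t) (@acos R)).
      exact: continuous_x0.
    by apply: continuous_acos; apply/andP; split; lra.
  apply: cvgM.
    apply: cvgM => //; apply: cvgV.
      by rewrite gt_eqF// sin_gt0_pi// acos_gt0 ?acos_ltpi//; apply/andP; split; lra.
    apply: (@continuous_comp _ _ _ (fun s => acos (x0 s)) (@sin R)) => //.
    exact: continuous_sin.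
  apply: cvgM.
    apply: cvgM; first exact: cvg_cst.
    by apply: cvgM; [exact: continuous_sin|exact: continuous_cos].
  have kE s : (Num.sqrt (k s))^-1 = x0 s / m s.
    by rewrite /circle_cos mulrAC mulfV ?mul1r// gt_eqF.
  under eq_fun do rewrite kE; rewrite kE.
  apply: cvgM; first exact: continuous_x0.
  apply: cvgV; first by rewrite gt_eqF.
  have cc := @continuous_cos R t; have cs := @continuous_sin R t.
  by apply: cvgD; apply: cvgM => //; apply: cvgM => //; exact: cvg_cst.
have cW : continuous W.
  move=> t; apply: cvgD; first exact: cD.
  apply: (@continuous_comp _ _ _ (fun t => - t) D); last exact: cD.
  exact: opp_continuous.
have cw := continuous_subspaceT (A := `[pi / 6, pi / 3]%classic) cW.
have [c hc h] := EVT_min ab cw.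
exists (W c); last by move=> t ht; apply: h; rewrite in_itv.
move: hc; rewrite in_itv/= => /andP[c1 c2].
apply: W_gt0; rewrite mulr_gt0 ?sin_gt0_pihalf ?cos_gt0_pihalf//.
  by apply/andP; split; lra.
by apply/andP; split; lra.
Qed.

Lemma circle_gain : exists N : nat, [/\ (0 < N)%N &
  let h := 2 * pi / N%:R in
  0 < \sum_(i < N) ((2^-1 * acos (x0 (i%:R * h)) ^+ 2 -
      2^-1 * acos (circle_cos (i%:R * h + h) (i%:R * h)) ^+ 2) +
     (2^-1 * acos (x0 (- (i%:R * h))) ^+ 2 -
      2^-1 * acos (circle_cos (- (i%:R * h) + h) (- (i%:R * h))) ^+ 2))].
Proof.
have p0 := @pi_gt0 R.
have [K [h0 [h00 K0 low]]] := gain_lower.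
have [eta eta0 We] := W_lower.
(* With 12 M vertices, M h = pi / 6, so the indices from M to 2 M - 1 fall into the interval of
   [W_lower] and contribute at least (h / 2) M eta. The errors add up to 4 pi K h, whence M > 8 pi K
   / eta. The other terms ensure [h < h0] and h <= 1 / 6, the latter for sin h >= h / 2. *)
pose M := (Num.truncn (8 * pi * K / eta) + Num.truncn (2 * pi / h0) + 4).+1.
exists (12 * M)%N; split; first by rewrite muln_gt0.
move=> h.
have M0 : 0 < M%:R :> R by rewrite ltr0n.
have M4 : 4 <= M%:R :> R by rewrite ler_nat /M ltnW// ltnS leq_addl.
have NhE : (12 * M)%:R * h = 2 * pi by rewrite /h mulrC divfK// gt_eqF// ltr0n muln_gt0.
have MhE : M%:R * h = pi / 6 by move: NhE; rewrite natrM; lra.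
have h_gt0 : 0 < h by rewrite -(pmulr_rgt0 _ M0) MhE; lra.
have [M1 M2] : 8 * pi * K / eta < M%:R /\ 2 * pi / h0 < M%:R.
  have t1 := truncnS_gt (8 * pi * K / eta).
  have t2 := truncnS_gt (2 * pi / h0).
  split; [apply: lt_le_trans t1 _|apply: lt_le_trans t2 _];
    rewrite ler_nat /M ltnS.
  - by rewrite -addnA leq_addr.
  - by rewrite addnAC leq_addl.
have hh0 : h < h0.
  rewrite -(ltr_pM2l M0) MhE; rewrite ltr_pdivrMr// in M2.
  by apply: lt_trans M2; lra.
have h6 : h <= 6^-1.
  have [/andP[_ h2] _] := pihalf_02_cos_pihalf R.
  have : 4 * h <= M%:R * h by rewrite ler_pM2r.
  by rewrite MhE; lra.
have ih i : (i < 12 * M)%N -> - (2 * pi) <= i%:R * h <= 2 * pi /\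
    - (2 * pi) <= - (i%:R * h) <= 2 * pi.
  move=> iM; have : i%:R * h <= (12 * M)%:R * h by rewrite ler_pM2r// ler_nat ltnW.
  have : 0 <= i%:R * h by rewrite mulr_ge0// ltW.
  by rewrite NhE => ? ?; split; apply/andP; split; lra.
apply: (@lt_le_trans _ _ (\sum_(i < 12 * M) (sin h * W (i%:R * h) - 2 * K * h ^+ 2))).
  rewrite big_split /= sumr_const card_ord -mulr_sumr.
  have SW : M%:R * eta <= \sum_(i < 12 * M) W (i%:R * h).
    have W0 a b : 0 <= \sum_(a <= i < b) W (i%:R * h) by exact: sumr_ge0.
    have S1 : M%:R * eta <= \sum_(M <= i < 2 * M) W (i%:R * h).
      have -> : M%:R * eta = \sum_(M <= i < 2 * M) eta.
        by rewrite sumr_const_nat mul2n -addnn addnK mulr_natl.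
      apply: ler_sum_nat => i /andP[i1 i2]; apply: We; apply/andP; split.
        by rewrite -MhE ler_pM2r// ler_nat.
      have : i%:R * h <= (2 * M)%:R * h by rewrite ler_pM2r// ler_nat ltnW.
      by rewrite natrM -mulrA MhE; lra.
    rewrite -(big_mkord xpredT (fun i => W (i%:R * h))).
    rewrite (@big_cat_nat _ _ _ M)//=; last by rewrite leq_pmull.
    rewrite [X in _ <= _ + X](@big_cat_nat _ _ _ (2 * M))//=; last 2 first.
      by rewrite leq_pmull.
      by rewrite leq_mul2r orbT.
    by apply: (le_trans S1); rewrite ler_wpDl// lerDl.
  have sh : h / 2 <= sin h.
    have /andP[/ltW sh _] : h * cos h < sin h < h.
      by have := @pihalf_ge1 R; move: h6 => ? ?; apply: lt_mulcos_sin; apply/andP; split; lra.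
    apply: le_trans sh; rewrite ler_pM2l//.
    have /andP[_ c1] := onem_cos_le h_gt0.
    have : h ^+ 2 <= 6^-1 ^+ 2 by rewrite ler_sqr ?nnegrE// ltW.
    by rewrite expr2; lra.
  rewrite ltr_pdivrMr// in M1.
  have s1 : h / 2 * (M%:R * eta) <= sin h * \sum_(i < 12 * M) W (i%:R * h).
    by apply: ler_pM => //; apply: ltW; [exact: divr_gt0|exact: mulr_gt0].
  have s2 : h / 2 * (8 * pi * K) < h / 2 * (M%:R * eta).
    by rewrite ltr_pM2l// divr_gt0.
  rewrite mulNrn subr_gt0; apply: lt_le_trans s1; apply: le_lt_trans s2.
  have -> : (2 * K * h ^+ 2) *+ (12 * M) = 2 * K * h * ((12 * M)%:R * h).
    by rewrite -[LHS]mulr_natr; ring.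
  by rewrite NhE le_eqVlt; apply/orP; left; apply/eqP; field.
apply: ler_sum => i _; have [i1 i2] := ih i (ltn_ord i).
have hB : 0 < h < h0 by rewrite h_gt0.
have := low _ _ i1 hB; have := low _ _ i2 hB; rewrite /W; lra.
Qed.

End circulation.

Section acos_limit.
Context {R : realType} {T : Type} {F : set_system T} {FF : Filter F}.

Let cvg_acos1 (f : T -> R) : (forall x, -1 <= f x <= 1) ->
  f x @[x --> F] --> (1 : R) -> acos (f x) @[x --> F] --> (0 : R).
Proof.
move=> fB f1; apply/cvgrPdist_lt => e e0.
pose d : R := Num.min e 1.
have d0 : 0 < d by rewrite lt_min e0 ltr01.
have d1 : d <= 1 by rewrite ge_min lexx orbT.
have pi2 := @pi_ge2 R.
have cd : cos d < 1 by rewrite -cos0 ltr_cos// ?in_itv/=; apply/andP; split; lra.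
have {f1} : \forall x \near F, cos d < f x by exact: cvgr_gt f1 _ cd.
apply: filterS => x cdx; have a0 := acos_ge0 (fB x).
rewrite sub0r normrN ger0_norm//; apply: (@lt_le_trans _ _ d); last first.
  by rewrite ge_min lexx.
rewrite -ltr_cos ?acosK ?in_itv//=; last by apply/andP; split; lra.
by rewrite a0 acos_lepi.
Qed.

(** The endpoints are included, so that no pair of points has to be kept from being equal or
    antipodal. The limit at -1 follows from that at 1 by acos (- x) = pi - acos x. *)
Lemma cvg_acos (f : T -> R) (a : R) : (forall x, -1 <= f x <= 1) ->
  -1 <= a <= 1 -> f x @[x --> F] --> a -> acos (f x) @[x --> F] --> acos a.
Proof.
move=> fB /andP[]; rewrite le_eqVlt => /predU1P[<- _ fa|aN1].
  have fBN x : -1 <= - f x <= 1 by have := fB x; lra.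
  rewrite -[acos (-1)](subKr pi) acosN1 subrr.
  under eq_fun do rewrite -[f _]opprK acosN//.
  apply: cvgB; first exact: cvg_cst.
  by apply: cvg_acos1 => //; rewrite -[X in _ --> X]opprK; exact: cvgN.
rewrite le_eqVlt => /predU1P[->|a1] fa; first by rewrite acos1; exact: cvg_acos1.
apply: (@cvg_comp _ _ _ f (@acos R) F _ _ fa).
by apply: continuous_acos; rewrite aN1 a1.
Qed.

End acos_limit.

Lemma mulmx_cV_inj (R : realType) m (M N : 'M[R]_m) :
  (forall x : 'cV[R]_m, M *m x = N *m x) -> M = N.
Proof.
move=> MN; apply/matrixP => i j.
by have /colP/(_ i) := MN (delta_mx j 0); rewrite -!colE !mxE.
Qed.

(** * Rotations of a plane and sums over regular polygons *)

Section plane_rotation.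
Context {R : realType} {m : nat}.
Variables (u v : 'cV[R]_m).
Hypotheses (uu : dotp u u = 1) (vv : dotp v v = 1) (uv : dotp u v = 0).
Implicit Types (d e t : R) (x : 'cV[R]_m).

Definition plane_rotation d : 'M[R]_m :=
  1%:M + (cos d - 1) *: (u *m u^T + v *m v^T) + sin d *: (v *m u^T - u *m v^T).

Local Notation rot := plane_rotation.

Let tensor (a b : 'cV[R]_m) x : (a *m b^T) *m x = dotp b x *: a.
Proof.
rewrite -mulmxA; have -> : b^T *m x = (dotp b x)%:M.
  apply/matrixP => i j; rewrite !ord1 !mxE mulr1n.
  by apply: eq_bigr => k _; rewrite mxE.
by rewrite mul_mx_scalar.
Qed.

Lemma plane_rotationE d x : rot d *m x =
  x + ((cos d - 1) * dotp u x - sin d * dotp v x) *: u +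
      ((cos d - 1) * dotp v x + sin d * dotp u x) *: v.
Proof.
rewrite /rot !mulmxDl mul1mx -!scalemxAl mulmxDl mulmxBl !tensor.
by apply/colP => i; rewrite !mxE; ring.
Qed.

Lemma plane_rotationD d e : rot d *m rot e = rot (d + e).
Proof.
apply: mulmx_cV_inj => x; rewrite -mulmxA !plane_rotationE.
rewrite !(dotpDr, dotpZr) (dotpC v u) uu vv uv cosD sinD.
by apply/colP => i; rewrite !mxE; ring.
Qed.

Lemma plane_rotation_id d : cos d = 1 -> rot d = 1%:M.
Proof.
move=> c1; have s0 : sin d = 0.
  by apply/eqP; rewrite -norm_cos_eq1 c1 normr1.
by rewrite /rot c1 s0 subrr !scale0r !addr0.
Qed.

Lemma plane_rotation_orthogonal d : orthogonal_mx (rot d).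
Proof.
rewrite /orthogonal_mx; have -> : (rot d)^T = rot (- d).
  apply/matrixP => i j; rewrite /rot cosN sinN !mxE.
  by rewrite eq_sym; congr (_ + _ + _); [congr (_ * _); congr (_ + _)|
    rewrite mulNr -mulrN opprB; congr (_ * (_ - _))];
    apply: eq_bigr => k _; rewrite !mxE mulrC.
by rewrite plane_rotationD addNr plane_rotation_id// cos0.
Qed.

Definition great_circle t : 'cV[R]_m := cos t *: u + sin t *: v.

Lemma plane_rotation_circle d t : rot d *m great_circle t = great_circle (t + d).
Proof.
rewrite plane_rotationE /great_circle !(dotpDr, dotpZr) (dotpC v u) uu vv uv.
rewrite cosD sinD; apply/colP => i; rewrite !mxE; ring.
Qed.

End plane_rotation.

Section periodic_sums.
Context {R : realType}.
Variables (N : nat) (h : R) (g : R -> R).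
Hypotheses (Nh : N%:R * h = 2 * pi) (gP : forall t, g (t + 2 * pi) = g t).

Lemma periodic_sum_shift :
  \sum_(i < N) g (- (i.+1%:R * h)) = \sum_(i < N) g (- (i%:R * h)).
Proof.
case: N Nh => [|n] nh; first by rewrite !big_ord0.
rewrite big_ord_recr [RHS]big_ord_recl /= addrC mul0r; congr (_ + _).
by rewrite nh -gP oppr0 addNr.
Qed.

Lemma periodic_sum_reflect :
  \sum_(i < N) g (i%:R * h) = \sum_(i < N) g (- (i%:R * h)).
Proof.
rewrite -periodic_sum_shift (reindex_inj rev_ord_inj) /=.
apply: eq_bigr => i _; rewrite -[RHS]gP; congr g.
by rewrite natrB ?ltn_ord// mulrBl Nh addrC.
Qed.

End periodic_sums.

(** * From the great circle to a cheaper map of the sphere *)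

Section three_eigenvalues_not_optimal.
Context {R : realType} {n : nat}.
Notation sph := (sphere R n).
Notation vol := (sphere_vol R n).
Variables (P : 'M[R]_n.+1) (u v : 'cV[R]_n.+1).
Hypotheses (sP : self_adjoint P) (pP : positive_definite P).
Hypotheses (uu : dotp u u = 1) (vv : dotp v v = 1) (uv : dotp u v = 0).
Hypothesis uPv : dotp u (P *m v) = 0.

Local Notation al := (dotp u (P *m u)).
Local Notation be := (dotp v (P *m v)).
Local Notation A := (dotp (P *m u) (P *m u)).
Local Notation B := (dotp (P *m v) (P *m v)).
Local Notation C := (dotp (P *m u) (P *m v)).
Hypotheses (beal : be < al) (C0 : 0 < C).

Local Notation pt := (great_circle u v).
Local Notation rot := (plane_rotation u v).
Local Notation T := (linear_image P : sph -> sph).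
Local Notation ccos := (circle_cos al be A B C).

Let vPu : dotp v (P *m u) = 0.
Proof. by rewrite dotpC dotp_symmx. Qed.

Let ptpt t : dotp (pt t) (pt t) = 1.
Proof.
rewrite !(dotpDl, dotpDr, dotpZl, dotpZr) (dotpC v u) uu vv uv.
by rewrite -[RHS](cos2Dsin2 t); ring.
Qed.

Let ptP s t : dotp (pt s) (P *m pt t) = circle_form al be s t.
Proof.
rewrite mulmxDr -!scalemxAr !(dotpDl, dotpDr, dotpZl, dotpZr) uPv vPu.
by rewrite /circle_form; ring.
Qed.

Let PptP t : dotp (P *m pt t) (P *m pt t) = circle_sqnorm A B C t.
Proof.
rewrite mulmxDr -!scalemxAr !(dotpDl, dotpDr, dotpZl, dotpZr).
by rewrite (dotpC (P *m v) (P *m u)) /circle_sqnorm; ring.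
Qed.

(** Pairing with u and v shows, as [al] and [be] differ, that an eigenvector on the circle is u or v
    up to sign; then <P u, P v> would be a multiple of <u, P v> or of <v, P u>, both 0. *)
Let pt_not_eigen t c : P *m pt t != c *: pt t.
Proof.
apply/eqP => Pc.
have hu : cos t * al = c * cos t.
  have := congr1 (dotp u) Pc; rewrite /great_circle mulmxDr -!scalemxAr.
  by rewrite !(dotpDr, dotpZr) uPv uu uv !mulr0 !addr0 mulr1.
have hv : sin t * be = c * sin t.
  have := congr1 (dotp v) Pc; rewrite /great_circle mulmxDr -!scalemxAr.
  by rewrite !(dotpDr, dotpZr) vPu vv (dotpC v u) uv !mulr0 !add0r mulr1.
have := cos2Dsin2 t; have [s0|s0] := eqVneq (sin t) 0.
  rewrite s0 expr0n addr0 => c2.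
  have c0 : cos t != 0.
    by apply: contra_eq_neq c2 => ->; rewrite expr0n eq_sym oner_eq0.
  have Pu : P *m u = c *: u.
    apply: (scalerI c0); move: Pc; rewrite /great_circle s0 !scale0r !addr0.
    by rewrite -scalemxAr => ->; rewrite !scalerA mulrC.
  by move: C0; rewrite Pu dotpZl uPv mulr0 ltxx.
have cbe : c = be by apply: (mulIf s0); rewrite -hv mulrC.
have [c0 _|c0] := eqVneq (cos t) 0; last first.
  by have : al = be; [apply: (mulfI c0); rewrite hu cbe mulrC|move=> E; move: beal; rewrite E ltxx].
have Pv : P *m v = c *: v.
  apply: (scalerI s0); move: Pc; rewrite /great_circle c0 !scale0r !add0r.
  by rewrite -scalemxAr => ->; rewrite !scalerA mulrC.
by move: C0; rewrite Pv dotpZr (dotpC _ v) vPu mulr0 ltxx.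
Qed.

Let form_lt t : circle_form al be t t ^+ 2 < circle_sqnorm A B C t.
Proof.
set f := circle_form al be t t.
have : 0 < dotp (P *m pt t - f *: pt t) (P *m pt t - f *: pt t).
  by rewrite dotp_gt0 subr_eq0.
rewrite !(dotpBl, dotpBr, dotpZl, dotpZr) ptpt PptP (dotpC (P *m pt t)) ptP -/f.
by rewrite expr2; lra.
Qed.

Let be0 : 0 < be.
Proof. by apply: pP; rewrite -dotp_gt0 vv. Qed.

Let P0 (p : sph) : P *m sphere_val p != 0.
Proof.
apply: contraTneq (pP (sphere_val_neq0 p)) => ->.
by rewrite dotp0r ltxx.
Qed.

Let costE (p q : sph) : cost p (T q) =
  2^-1 * acos (dotp (sphere_val p) (P *m sphere_val q) /
               enorm (P *m sphere_val q)) ^+ 2.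
Proof.
by rewrite /cost /gdist linear_imageE// dotpZr (mulrC (enorm _)^-1).
Qed.

Let ccosE s t :
  dotp (pt s) (P *m pt t) / enorm (P *m pt t) = ccos s t.
Proof. by rewrite ptP /enorm PptP. Qed.

Let ccosP s t : ccos (s + 2 * pi) t = ccos s t /\ ccos s (t + 2 * pi) = ccos s t.
Proof.
have pc (x : R) : cos (x + 2 * pi) = cos x by rewrite [2 * pi]mulr_natl cosD2pi.
have ps (x : R) : sin (x + 2 * pi) = sin x by rewrite [2 * pi]mulr_natl sinD2pi.
by rewrite /circle_cos /circle_form /circle_sqnorm !pc !ps.
Qed.

Let iter_rot d i (p : sph) :
  sphere_val (iter i (linear_image (rot d)) p) = rot (i%:R * d) *m sphere_val p.
Proof.
have oR e : orthogonal_mx (rot e) by exact: plane_rotation_orthogonal.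
elim: i => [|i IHi]; first by rewrite mul0r (plane_rotation_id _ _ (cos0 R)) mul1mx.
rewrite iterS orthogonal_linear_imageE// IHi mulmxA plane_rotationD//.
by rewrite mulrSr mulrDl mul1r addrC.
Qed.

Let p0 : sph := mk_sphere (etrans (congr1 Num.sqrt uu) (sqrtr1 R)).

Let p0E : sphere_val p0 = pt 0.
Proof. by rewrite /great_circle cos0 sin0 scale1r scale0r addr0. Qed.

Let c s t := 2^-1 * acos (ccos s t) ^+ 2.

(** The rotation is by [- h] because [circle_gain] pairs the source at t + h with the image of the
    point at t. By periodicity the angles i h and - i h each run once over the polygon, whence the
    factor 2. *)
Let gainE N h : (0 < N)%N -> N%:R * h = 2 * pi ->
  2 * cycle_gain T (linear_image (rot (- h))) N p0 =
  \sum_(i < N) ((c (i%:R * h) (i%:R * h) - c (i%:R * h + h) (i%:R * h)) +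
     (c (- (i%:R * h)) (- (i%:R * h)) - c (- (i%:R * h) + h) (- (i%:R * h)))).
Proof.
move=> N0 Nh; pose e t := c t t; pose f t := c (t + h) t.
have eP t : e (t + 2 * pi) = e t by rewrite /e /c !(ccosP _ _).1 !(ccosP _ _).2.
have fP t : f (t + 2 * pi) = f t.
  by rewrite /f /c addrAC !(ccosP _ _).1 !(ccosP _ _).2.
rewrite !big_split /= !sumrN (periodic_sum_reflect Nh eP) (periodic_sum_reflect Nh fP).
rewrite -[X in _ - X + (_ - X)](periodic_sum_shift Nh fP).
have -> : cycle_gain T (linear_image (rot (- h))) N p0 =
    \sum_(i < N) (e (- (i%:R * h)) - f (- (i.+1%:R * h))).
  apply: eq_bigr => i _; rewrite !costE !iter_rot p0E !plane_rotation_circle//.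
  rewrite !add0r !mulrN !ccosE /e /f /c; congr (_ - 2^-1 * acos (ccos _ _) ^+ 2).
  by rewrite mulrSr mulrDl mul1r; ring.
by rewrite big_split /= sumrN; ring.
Qed.

Let gain_cvg U N d : U = linear_image (rot d) ->
  cycle_gain T U N p @[p --> p0] --> cycle_gain T U N p0.
Proof.
move=> UE.
have cc i j : cost (iter i U p) (T (iter j U p)) @[p --> p0] -->
    cost (iter i U p0) (T (iter j U p0)).
  have cx k : sphere_val p k 0 @[p --> p0] --> sphere_val p0 k 0.
    apply: (@continuous_comp _ _ _ (@sphere_val R n) (fun u => u k 0)).
      exact: sphere_val_continuous.
    exact: coord_continuous.
  have cr l k : sphere_val (iter l U p) k 0 @[p --> p0] -->
      sphere_val (iter l U p0) k 0.
    rewrite UE; under eq_fun do rewrite iter_rot; rewrite iter_rot.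
    exact: (@cvg_mulmx_coord _ _ _ (nbhs_filter p0)).
  have cP k : (P *m sphere_val (iter j U p)) k 0 @[p --> p0] -->
      (P *m sphere_val (iter j U p0)) k 0.
    by apply: (@cvg_mulmx_coord _ _ _ (nbhs_filter p0)) => k'; exact: cr.
  have ca : acos (dotp (sphere_val (iter i U p)) (sphere_val (T (iter j U p))))
      @[p --> p0] -->
      acos (dotp (sphere_val (iter i U p0)) (sphere_val (T (iter j U p0)))).
    apply: (@cvg_acos _ _ _ (nbhs_filter p0)) => [p||]; try exact: dotp_sphere_itv.
    have dE p : dotp (sphere_val (iter i U p)) (sphere_val (T (iter j U p))) =
        (enorm (P *m sphere_val (iter j U p)))^-1 *
        dotp (sphere_val (iter i U p)) (P *m sphere_val (iter j U p)).
      by rewrite linear_imageE// dotpZr.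
    under eq_fun do rewrite dE; rewrite dE.
    apply: cvgM; last first.
      by apply: (@cvg_dotp _ _ _ (nbhs_filter p0)) => k; [exact: cr|exact: cP].
    apply: cvgV; first by rewrite gt_eqF// enorm_gt0.
    by apply: (@cvg_enorm _ _ _ (nbhs_filter p0)) => k; exact: cP.
  apply: (@cvgM _ _ _ (nbhs_filter p0)); first exact: cvg_cst.
  apply: (@cvg_comp _ _ _ _ (fun x : R => x ^+ 2) _ _ _ ca).
  exact: exprn_continuous.
rewrite /cycle_gain.
apply: (@cvg_big _ _ _ _ _ _ _ _ _ _ _ (nbhs_filter p0)) => [|i _].
  exact: add_continuous.
exact: (@cvgB _ _ _ _ (nbhs_filter p0)).
Qed.

Lemma circle_not_optimal (nu : set sph -> \bar R) (T' : sph -> sph) :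
  optimal_map vol nu T' -> ~ {ae vol, forall p, T' p = T p}.
Proof.
move=> oT' TT'.
have [N [N0 gain]] := circle_gain be0 beal C0 form_lt.
pose h : R := 2 * pi / N%:R.
have Nh : N%:R * h = 2 * pi by rewrite mulrC divfK// pnatr_eq0 -lt0n.
have {}gain : 0 < cycle_gain T (linear_image (rot (- h))) N p0.
  by rewrite -(@pmulr_rgt0 _ 2)// (gainE N0 Nh); exact: gain.
pose U : sph -> sph := linear_image (rot (- h)).
have oR : orthogonal_mx (rot (- h)) by exact: plane_rotation_orthogonal.
have VU : volume_preserving U.
  apply: (volume_preserving_orthogonal oR) => p.
  exact: orthogonal_linear_imageE.
have UN p : iter N U p = p.
  apply: sphere_val_inj; rewrite iter_rot mulrN Nh plane_rotation_id ?mul1mx//.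
  by rewrite cosN mulr_natl cos2pi.
have [mG G0] := optimal_cycle_gain oT' (measurable_linear_image P) TT' VU N0 UN.
have : (0 < vol [set p | (0 < cycle_gain T U N p)%R])%E.
  apply: (sphere_vol_gt0 (p := p0) mG).
  exact: (@cvgr_gt _ _ _ (nbhs_filter p0) _ _ (gain_cvg (erefl U)) _ gain).
by rewrite G0 ltxx.
Qed.

End three_eigenvalues_not_optimal.

Lemma coincide_two_eigenvalues (R : realType) (n : nat) (P O : 'M[R]_n.+1)
    (S : sphere R n -> sphere R n) :
  self_adjoint P -> positive_definite P ->
  factorizations_coincide S P O -> at_most_two_eigenvalues P.
Proof.
move=> sP pP [[T [U TU]] /(_ _ _ TU)[TP _]]; apply: contrapT => P3.
have [_ oT _] := TU.
have {}TP : {ae sphere_vol R n, forall p, T p = linear_image P p}.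
  apply: filterS TP => p Tp; apply: sphere_val_inj; rewrite Tp linear_imageE//.
  apply: contraTneq (pP _ (sphere_val_neq0 p)) => ->.
  by rewrite dotp0r ltxx.
have [u [v [uu vv uv uPv pos]]] := conjugate_plane sP P3.
have [C0|C0|C0] := ltgtP 0 (dotp (P *m u) (P *m v)); last 1 first.
- by move: pos; rewrite -C0 mul0r ltxx.
- rewrite pmulr_rgt0// subr_gt0 in pos.
  exact: (circle_not_optimal sP pP uu vv uv uPv pos C0 oT TP).
rewrite nmulr_rgt0// subr_lt0 in pos.
(* When <P u, P v> < 0, passing from (u, v) to (v, - u) exchanges <u, P u> with <v, P v> and
   reverses the sign of <P u, P v>. *)
apply: (@circle_not_optimal _ _ P v (- u) sP pP _ _ _ _ _ _ _ _ oT TP) => //.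
- by rewrite dotpNl dotpNr opprK.
- by rewrite dotpNr dotpC uv oppr0.
- by rewrite mulmxN dotpNr dotpC dotp_symmx// uPv oppr0.
- by rewrite mulmxN dotpNl dotpNr opprK.
- by rewrite mulmxN dotpNr dotpC oppr_gt0.
Qed.

Theorem theorem2 (R : realType) (n : nat) (hn : (1 <= n)%N)
    (A P O : 'M[R]_n.+1) (S : sphere R n -> sphere R n)
    (hA : 0 < \det A) (hS : induced_by A S)
    (hAPO : A = P *m O)
    (hPsym : self_adjoint P) (hPpos : positive_definite P)
    (hO : orthogonal_mx O) :
  factorizations_coincide S P O <-> at_most_two_eigenvalues P.
Proof.
rewrite hAPO in hS; split; first exact: coincide_two_eigenvalues.
exact: two_eigenvalues_coincide.
Qed.
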